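(* There is a polynomial-time $\left(1+\frac{k-2}{k}\max_{i,j}\frac{B_j}{B_i}\right)$-resource-augmented algorithm for Returning BudgetedDelivery, where $k$ is the number of agents and $B_1,\dots,B_k$ are their budgets.
   Context: BudgetedDelivery: we are given an undirected graph $G=(V,E)$ with non-negative edge weights $w(e)$ (the energy needed to traverse edge $e$ in either direction; traversing a fraction of an edge costs the corresponding fraction of its weight), two vertices $s\neq t$, and $k$ mobile agents, agent $i$ starting at vertex $p_i$ with an energy budget $B_i> 0$ bounding its total travelled distance. A message is initially at $s$. An agent can pick up the message at its current location, carry it, and drop it at any location (a vertex or a point inside an edge), where another agent may later pick it up. A schedule is feasible if the message is delivered from $s$ to $t$ and no agent exceeds its budget; in the Returning version each agent must additionally end at its starting position $p_i$ within its budget. For $\gamma>1$, a $\gamma$-resource-augmented algorithm is a polynomial-time algorithm that, given an instance, either correctly answers that no feasible schedule exists (with the original budgets), or outputs a feasible schedule for the modified instance in which every budget is replaced by $\gamma\cdot B_i$. *)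

(* Defs.v *)
From mathcomp Require Import all_boot all_order all_algebra reals.

Set Implicit Arguments.
Unset Strict Implicit.
Unset Printing Implicit Defensive.

Import Order.TTheory GRing.Theory Num.Theory.
Local Open Scope ring_scope.

(* Model of computation: a first-order call-by-value language over binary trees
   of integers, with logarithmic costs.  Every evaluation step pays at least the
   bit size of the value it produces (so that the arguments of an operation are
   paid for too, see eval_size); integers are written in binary.  Running times
   are thus polynomially related to those of Turing machines. *)

Inductive val := Int of int | Pair of val & val.

Fixpoint vsize (v : val) : nat :=
  match v with
  | Int z => (trunc_log 2 `|z|%N).+2
  | Pair a b => (vsize a + vsize b).+1
  end.

Inductive binop := Add | Sub | Mul | Quo | Leq.

Definition arith (o : binop) (a b : int) : int :=
  match o with
  | Add => a + b
  | Sub => a - b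
  | Mul => a * b
  | Quo => (a %/ b)%Z
  | Leq => Posz (a <= b)%R
  end.

Inductive expr :=
  | Var of nat  (* de Bruijn index *)
  | Cst of int
  | Bin of binop & expr & expr
  | Cons of expr & expr
  | Fst of expr
  | Snd of expr
  | IsPair of expr
  | If of expr & expr & expr
  | Let of expr & expr
  | Call of nat & expr.

(* The bodies of mutually recursive one-argument functions (the argument is
   Var 0); the first one is the entry point. *)
Definition program := seq expr.

(* eval P env e v c : in environment env, e evaluates to v at cost c. *)
Inductive eval (P : program) : seq val -> expr -> val -> nat -> Prop :=
  | EVar env n v : onth env n = Some v -> eval P env (Var n) v (vsize v)
  | ECst env z : eval P env (Cst z) (Int z) (vsize (Int z))
  | EBin env o e1 e2 a b c1 c2 :
      eval P env e1 (Int a) c1 -> eval P env e2 (Int b) c2 ->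
      eval P env (Bin o e1 e2) (Int (arith o a b))
        (c1 + c2 + vsize (Int (arith o a b)))
  | ECons env e1 e2 a b c1 c2 :
      eval P env e1 a c1 -> eval P env e2 b c2 ->
      eval P env (Cons e1 e2) (Pair a b) (c1 + c2 + vsize (Pair a b))
  | EFst env e a b c :
      eval P env e (Pair a b) c -> eval P env (Fst e) a (c + vsize a)
  | ESnd env e a b c :
      eval P env e (Pair a b) c -> eval P env (Snd e) b (c + vsize b)
  | EIsPairT env e a b c :
      eval P env e (Pair a b) c -> eval P env (IsPair e) (Int 1) (c + vsize (Int 1))
  | EIsPairF env e z c :
      eval P env e (Int z) c -> eval P env (IsPair e) (Int 0) (c + vsize (Int 0))
  | EIfT env e e1 e2 z v c c1 :
      eval P env e (Int z) c -> z != 0 -> eval P env e1 v c1 ->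
      eval P env (If e e1 e2) v (c + c1).+1
  | EIfF env e e1 e2 v c c2 :
      eval P env e (Int 0) c -> eval P env e2 v c2 ->
      eval P env (If e e1 e2) v (c + c2).+1
  | ELet env e1 e2 a v c1 c2 :
      eval P env e1 a c1 -> eval P (a :: env) e2 v c2 ->
      eval P env (Let e1 e2) v (c1 + c2).+1
  | ECall env f e body a v c c' :
      eval P env e a c -> onth P f = Some body -> eval P [:: a] body v c' ->
      eval P env (Call f e) v (c + c').+1.

Definition runs (P : program) (input output : val) (cost : nat) : Prop :=
  eval P [:: input] (Call 0 (Var 0)) output cost.

Lemma eval_size P env e v c : eval P env e v c -> (vsize v <= c)%N.
Proof.
by elim=> //= *; rewrite ?leq_addl //; apply: leqW; apply: leq_trans (leq_addl _ _).
Qed.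

Lemma eval_det P env e v c v' c' :
  eval P env e v c -> eval P env e v' c' -> v = v' /\ c = c'.
Proof.
move=> H; elim: H v' c' => *;
  match goal with K : eval _ _ _ _ _ |- _ = _ /\ _ =>
    repeat match goal with L : eval _ _ _ _ _ |- _ =>
      assert_fails (constr_eq K L); clear L end;
    inversion K; subst; clear K
  end;
  repeat match goal with
    | IH : forall v c, eval P ?rho ?f v c -> _, K : eval P ?rho ?f _ _ |- _ =>
        let E := fresh in let E' := fresh in
        have [E E'] := IH _ _ K; clear IH K; (discriminate E || injection E || idtac);
        intros; subst
    | K : onth ?s ?n = Some _, K' : onth ?s ?n = Some _ |- _ =>
        rewrite K in K'; injection K'; clear K'; intros; subst
    end; by [].
Qed.

(* Instances of BudgetedDelivery, with rational data. *)

Record instance := Instance {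
  nv : nat;  (* number of vertices *)
  na : nat;  (* number of agents *)
  edge : rel 'I_nv;
  weight : 'I_nv -> 'I_nv -> rat;  (* relevant on edges only *)
  src : 'I_nv;
  tgt : 'I_nv;
  home : 'I_na -> 'I_nv;
  budget : 'I_na -> rat;
  edge_sym : symmetric edge;
  edge_irr : irreflexive edge;
  weight_sym : forall u v, edge u v -> weight u v = weight v u;
  weight_ge0 : forall u v, edge u v -> 0 <= weight u v;
  src_neq_tgt : src != tgt;
  budget_gt0 : forall i, 0 < budget i
}.

(* Graph as adjacency lists; rationals as binary numerator and denominator. *)

Definition enc_seq (s : seq val) : val := foldr Pair (Int 0) s.
Definition enc_ord n (i : 'I_n) : val := Int (Posz i).
Definition enc_rat (q : rat) : val := Pair (Int (numq q)) (Int (denq q)).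

Definition enc_instance (I : instance) : val :=
  let adj u := [seq Pair (enc_ord v) (enc_rat (weight u v))
               | v <- enum 'I_(nv I) & edge u v] in
  let agents := [seq Pair (enc_ord (home i)) (enc_rat (budget i))
                | i <- enum 'I_(na I)] in
  Pair (enc_seq [seq enc_seq (adj u) | u <- enum 'I_(nv I)])
    (Pair (enc_ord (src I)) (Pair (enc_ord (tgt I)) (enc_seq agents))).

Section Schedules.
Variables (R : realType) (I : instance).

Let V := 'I_(nv I).
Let agent := 'I_(na I).

(* A vertex, or the point inside an edge {u, v} with u < v that lies at the
   given fraction of the edge, measured from u. *)
Definition loc : Type := (V + V * V * R)%type.

(* The point at fraction x of the edge {u, v}, measured from u; by construction
   point u v x = point v u (1 - x) when u <> v. *)
Definition point (u v : V) (x : R) : loc :=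
  if x == 0 then inl u else
  if x == 1 then inl v else
  if (u < v)%N then inr (u, v, x) else inr (v, u, 1 - x).

Inductive action :=
  | Walk of agent & V & V & R & R  (* along edge {u, v}, from point x to point y *)
  | PickUp of agent
  | Drop of agent.

(* Agents may wait for each other, so a schedule is a sequentialization of the
   actions of all agents. *)
Definition schedule := seq action.

Record state := State {
  pos : agent -> loc;
  msg : loc + agent  (* lying at a location, or carried by an agent *)
}.

Definition init : state := State (fun i => inl (home i)) (inl (inl (src I))).

Definition step (st : state) (a : action) : option state :=
  match a with
  | Walk i u v x y =>
      if [&& edge u v, 0 <= x <= 1, 0 <= y <= 1 & pos st i == point u v x]
      then Some (State (fun j => if j == i then point u v y else pos st j) (msg st))
      else None
  | PickUp i =>
      if msg st == inl (pos st i) then Some (State (pos st) (inr i)) else None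
  | Drop i =>
      if msg st == inr i then Some (State (pos st) (inl (pos st i))) else None
  end.

Definition run (sc : schedule) : option state :=
  foldl (fun st a => obind (step^~ a) st) (Some init) sc.

Definition walked (i : agent) (a : action) : R :=
  if a is Walk j u v x y then
    if j == i then `|y - x| * ratr (weight u v) else 0
  else 0.

Definition travelled (i : agent) (sc : schedule) : R := \sum_(a <- sc) walked i a.

(* The Returning version, for budgets B. *)
Definition feasible (B : agent -> R) (sc : schedule) : Prop :=
  exists st : state,
    [/\ run sc = Some st,
        msg st = inl (inl (tgt I)),
        forall i, pos st i = inl (home i) &
        forall i, travelled i sc <= B i].

(* Reading schedules from values.  Fractions need not be in lowest terms. *)

Definition dec_ord n (v : val) : option 'I_n :=
  if v is Int (Posz m) then insub m else None.

Definition dec_frac (v : val) : option R :=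
  if v is Pair (Int a) (Int b) then
    if b == 0 then None else Some (a%:~R / b%:~R)
  else None.

Definition dec_action (v : val) : option action :=
  match v with
  | Pair (Int (Posz 0)) (Pair i (Pair u (Pair v (Pair x y)))) =>
      if (dec_ord (na I) i, dec_ord (nv I) u, dec_ord (nv I) v,
          dec_frac x, dec_frac y)
        is (Some i, Some u, Some v, Some x, Some y)
      then Some (Walk i u v x y) else None
  | Pair (Int (Posz 1)) i => omap PickUp (dec_ord _ i)
  | Pair (Int (Posz 2)) i => omap Drop (dec_ord _ i)
  | _ => None
  end.

Fixpoint dec_schedule (v : val) : option schedule :=
  match v with
  | Int (Posz 0) => Some [::]
  | Pair a w =>
      if (dec_action a, dec_schedule w) is (Some a, Some sc)
      then Some (a :: sc) else None
  | _ => None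
  end.

(* An answer is either 0 (no feasible schedule exists, with arbitrary real
   positions allowed) or a pair of 1 and a schedule. *)
Definition correct_answer (gamma : rat) (v : val) : Prop :=
  (v = Int 0 /\ forall sc, ~ feasible (fun i => ratr (budget i)) sc) \/
  (exists w sc, [/\ v = Pair (Int 1) w, dec_schedule w = Some sc &
                    feasible (fun i => ratr (gamma * budget i)) sc]).

End Schedules.

(* P is a polynomial-time gamma-resource-augmented algorithm for Returning
   BudgetedDelivery on the instances in D; gamma may depend on the instance. *)
Definition resource_augmented (R : realType) (D : pred instance)
    (gamma : instance -> rat) (P : program) : Prop :=
  exists c d : nat, forall I : instance, D I ->
    exists v cost,
      [/\ runs P (enc_instance I) v cost,
          (cost <= c * vsize (enc_instance I) ^ d)%N &
          @correct_answer R I (gamma I) v].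

(* Main.v *)
(** Agents in [Returning BudgetedDelivery] can be assumed to carry the message
    one after the other.  Guess the first agent [a] and the last agent [b], and a
    vertex [x] up to which [a] goes with the message from [s] and a vertex [y] from
    which [b] starts towards [t].  Subtracting from the budgets of [a] and [b] the
    tours through their home, [s] and [x], resp. [t] and [y], leaves residual
    budgets of agents based at [x] and [y]; the other agents are based at home with
    their full budget.  If two agents visit a common point in a feasible schedule,
    then twice the distance of suitable bases is at most the sum of their residual
    budgets, so a shortest path from [a] to [b] in the graph of these pairs of agents
    exists unless there is no feasible schedule (or a single agent suffices).

    Conversely, along such a path of agents [1, ..., m], agent [i] hands the message
    to agent [i + 1] on a shortest route between their bases, at distance
    [res_i / 2 + (k - 2 i) beta / (2 k)] from base [i] (clamped to the route), where
    [beta] is the largest budget and [k] the number of agents.  The shifts by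
    [(k - 2 i) beta / (2 k)] spread the excess of the inner agents evenly: everyone
    exceeds its budget by at most [(k - 2) / k * beta]. *)

Require Import Defs.
From mathcomp Require Import all_boot all_order all_algebra reals boolp.
From mathcomp Require Import zify ring lra.
Import Order.TTheory GRing.Theory Num.Theory.

Set Implicit Arguments.
Unset Strict Implicit.
Unset Printing Implicit Defensive.

(** * Programs computing functions in polynomial time *)

Local Open Scope nat_scope.

(** Handovers may lie inside edges, yet guessing vertices suffices. In the tour of an agent through
    a handover point, the two legs at that point either use the same endpoint of its edge, so that
    the point is a detour from a tour through this vertex, or they cover the whole edge, so that
    both endpoints already lie on the tour. The excess arises because each meeting is tested
    separately: an inner agent passes the test at both of its meetings, and so may have to spend its
    budget once for each. With s_i = (k - 2 i) beta / (2 k), agent i walks at most res_i / 2 -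
    s_(i-1) to its pick-up and res_i / 2 + s_i to its drop. Consecutive shifts differ by beta / k,
    so walking both distances forth and back costs at most 2 res_i - 2 beta / k, and res_i <= beta
    turns this into res_i + (k - 2) / k beta. On the side of complexity, the obstacle is iteration:
    a loop with a cheap body may still build huge values, so every loop comes with a bound on its
    intermediate values. Clearing denominators once leaves only integer arithmetic on lengths. *)

Fixpoint shift_calls n (e : expr) : expr :=
  match e with
  | Var i => Var i
  | Cst z => Cst z
  | Bin o e1 e2 => Bin o (shift_calls n e1) (shift_calls n e2)
  | Defs.Cons e1 e2 => Defs.Cons (shift_calls n e1) (shift_calls n e2)
  | Fst e => Fst (shift_calls n e)
  | Snd e => Snd (shift_calls n e)
  | IsPair e => IsPair (shift_calls n e)
  | If e e1 e2 => If (shift_calls n e) (shift_calls n e1) (shift_calls n e2)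
  | Let e1 e2 => Let (shift_calls n e1) (shift_calls n e2)
  | Call f e => Call (n + f) (shift_calls n e)
  end.

Lemma shift_calls0 e : shift_calls 0 e = e.
Proof. by elim: e => //= *; rewrite ?add0n; congruence. Qed.

Lemma onth_cat_l T (s1 s2 : seq T) n x :
  onth s1 n = Some x -> onth (s1 ++ s2) n = Some x.
Proof. by elim: s1 n => [|y s IH] [|n] //=; apply: IH. Qed.

Lemma onth_link (L P R : program) f body : onth P f = Some body ->
  onth (L ++ map (shift_calls (size L)) P ++ R) (size L + f) = Some (shift_calls (size L) body).
Proof.
move=> H; elim: {1 3}L => [|? ? IH] //=; apply: onth_cat_l.
by elim: P f H => [|y s IH] [|n] //=; [case=> -> | apply: IH].
Qed.

(** Call targets are absolute positions, so code placed behind [L] must have its calls moved by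
    [size L]. Appending [env'] at the far end keeps all de Bruijn indices valid, and a called body
    starts again from its argument alone. *)
Lemma eval_link P env e v c L R env' : eval P env e v c ->
  eval (L ++ map (shift_calls (size L)) P ++ R) (env ++ env') (shift_calls (size L) e) v c.
Proof.
move=> H; elim: H env' => {env e v c} /=; try by intros; econstructor; eauto.
- by move=> env n v H env'; constructor; apply: onth_cat_l.
- move=> env f e body a v c c' _ IH1 Hb _ IH2 env'.
  apply: ECall (IH1 _) (onth_link _ _ Hb) _.
  by have := IH2 [::].
Qed.

(** Canonical instances infer the encoding from the type, so that [polyt] can be stated about
    ordinary functions. *)
Structure codeType := CodeType { code_sort :> Type; enc : code_sort -> Defs.val }.

Canonical val_codeType := CodeType (@id Defs.val).
Canonical int_codeType := CodeType Int.
Canonical nat_codeType := CodeType (fun n : nat => Int (Posz n)).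
Canonical bool_codeType := CodeType (fun b : bool => Int (Posz b)).
Canonical prod_codeType (A B : codeType) :=
  CodeType (fun p : A * B => Pair (enc p.1) (enc p.2)).
Canonical seq_codeType (A : codeType) := CodeType (fun s : seq A => enc_seq (map (@enc A) s)).
(** Chosen to match the two answers in [correct_answer]: [None] is [Int 0] and [Some w] is a pair of
    1 and the code of [w]. *)
Canonical option_codeType (A : codeType) :=
  CodeType (fun o : option A => if o is Some a then Pair (Int 1) (enc a) else Int 0).

Definition csize (T : codeType) (a : T) : nat := vsize (enc a).

Lemma vsize_gt1 v : 1 < vsize v.
Proof. by elim: v => //= v1 H1 v2 H2; lia. Qed.

Lemma csize_gt1 (T : codeType) (a : T) : 1 < csize a.
Proof. exact: vsize_gt1. Qed.

Lemma csize_pair (A B : codeType) (a : A) (b : B) :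
  csize (a, b) = (csize a + csize b).+1.
Proof. by []. Qed.

Lemma csize_fst (A B : codeType) (p : A * B) : csize p.1 <= csize p.
Proof. by rewrite /csize /= -/(csize _); lia. Qed.

Lemma csize_snd (A B : codeType) (p : A * B) : csize p.2 <= csize p.
Proof. by rewrite /csize /= -/(csize _); lia. Qed.

Lemma csize_nil (A : codeType) : csize (@nil A) = 2.
Proof. by rewrite /csize /= trunc_log0. Qed.

Lemma csize_cons (A : codeType) (a : A) s : csize (a :: s) = (csize a + csize s).+1.
Proof. by []. Qed.

Lemma csize_cat (A : codeType) (s1 s2 : seq A) : csize (s1 ++ s2) + 2 = csize s1 + csize s2.
Proof.
by elim: s1 => [|x s IH]; rewrite ?cat0s ?cat_cons ?csize_cons ?csize_nil; lia.
Qed.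

Lemma csize_size (A : codeType) (s : seq A) : size s <= csize s.
Proof. by elim: s => //= x s; rewrite csize_cons; lia. Qed.

(* Since every value has size at least 2, a polynomial bound is a pure power. *)
Definition pbounded (A : codeType) (F : A -> nat) := exists d, forall a, F a <= csize a ^ d.

Section PolyBound.
Variable A : codeType.
Implicit Types F G : A -> nat.

Lemma pbounded_le F G : (forall a, F a <= G a) -> pbounded G -> pbounded F.
Proof. by move=> le [d Hd]; exists d => a; apply: leq_trans (le a) (Hd a). Qed.

Lemma pbounded_const n : pbounded (fun _ : A => n).
Proof. by exists n => a; apply/ltnW/ltn_expl/csize_gt1. Qed.

Lemma pbounded_vs : pbounded (fun a : A => csize a).
Proof. by exists 1 => a; rewrite expn1. Qed.

Lemma pbounded_mul F G : pbounded F -> pbounded G -> pbounded (fun a => F a * G a).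
Proof.
by move=> [d Hd] [d' Hd']; exists (d + d') => a; rewrite expnD leq_mul.
Qed.

Lemma pbounded_add F G : pbounded F -> pbounded G -> pbounded (fun a => F a + G a).
Proof.
move=> [d Hd] [d' Hd']; exists (d + d').+1 => a; rewrite expnS.
have v1 := csize_gt1 a; have v0 : 0 < csize a by exact: ltnW.
have H1 : csize a ^ d <= csize a ^ (d + d') by rewrite leq_exp2l // leq_addr.
have H2 : csize a ^ d' <= csize a ^ (d + d') by rewrite leq_exp2l // leq_addl.
apply: (@leq_trans (2 * csize a ^ (d + d'))); last by rewrite leq_mul2r v1 orbT.
by rewrite mul2n -addnn leq_add // ?(leq_trans (Hd a)) ?(leq_trans (Hd' a)).
Qed.

Lemma pbounded_comp (B : codeType) (F : B -> nat) (f : A -> B) :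
  pbounded F -> pbounded (fun a => csize (f a)) -> pbounded (fun a => F (f a)).
Proof.
move=> [d Hd] [d' Hd']; exists (d' * d) => a; rewrite expnM.
apply: leq_trans (Hd _) _.
by have [->|d0] := posnP d; [rewrite !expn0 | rewrite leq_exp2r].
Qed.

End PolyBound.
Arguments pbounded_const {A} n.
Arguments pbounded_vs {A}.

(** Here [e] is an open expression evaluated next to [P], with the argument as its only variable; it
    becomes the entry point of a program only at the very end, in [polyt_program]. *)
Definition polyt (A B : codeType) (f : A -> B) : Prop :=
  exists P e (cost : A -> nat), pbounded cost /\
    forall a, exists2 c, eval P [:: enc a] e (enc (f a)) c & c <= cost a.

(** Producing a value costs at least its size, so a time bound is also a bound on the output;
    composition relies on this. *)
Lemma polyt_size (A B : codeType) (f : A -> B) :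
  polyt f -> pbounded (fun a => csize (f a)).
Proof.
move=> [P [e [cost [pc H1]]]]; apply: pbounded_le pc => a.
by have [c /eval_size] := H1 a; apply: leq_trans.
Qed.

Lemma pbounded_polyt (A B : codeType) (F : B -> nat) (f : A -> B) :
  polyt f -> pbounded F -> pbounded (fun a => F (f a)).
Proof. by move=> /polyt_size pf pF; apply: pbounded_comp. Qed.

Definition computed (A B : codeType) (P : program) (e : expr)
    (cost : A -> nat) (f : A -> B) :=
  forall a env, exists2 c, eval P (enc a :: env) e (enc (f a)) c & c <= cost a.

(** Three is the largest number of subexpressions of a construct ([If]). The last function has a
    domain of its own, since in a composition it is applied to the result of another one. *)
Lemma polyt_link3 (A B1 B2 B3 A3 : codeType) (f1 : A -> B1) (f2 : A -> B2) (f3 : A3 -> B3) :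
  polyt f1 -> polyt f2 -> polyt f3 ->
  exists P e1 e2 e3 cost1 cost2 cost3,
    [/\ pbounded cost1, pbounded cost2 & pbounded cost3] /\
    [/\ computed P e1 cost1 f1, computed P e2 cost2 f2 & computed P e3 cost3 f3].
Proof.
move=> [P1 [e1 [c1 [pc1 E1]]]] [P2 [e2 [c2 [pc2 E2]]]] [P3 [e3 [c3 [pc3 E3]]]].
exists (P1 ++ map (shift_calls (size P1)) P2 ++
  map (shift_calls (size (P1 ++ map (shift_calls (size P1)) P2))) P3).
exists e1, (shift_calls (size P1) e2), (shift_calls (size (P1 ++ map (shift_calls (size P1)) P2)) e3).
exists c1, c2, c3.
do 2!split=> //.
- move=> a env; have [c E le] := E1 a; exists c => //.
  have := eval_link [::] (map (shift_calls (size P1)) P2 ++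
    map (shift_calls (size (P1 ++ map (shift_calls (size P1)) P2))) P3) env E.
  by rewrite /= shift_calls0 (eq_map shift_calls0) map_id.
- move=> a env; have [c E le] := E2 a; exists c => //.
  exact: eval_link E.
- move=> a env; have [c E le] := E3 a; exists c => //.
  have := eval_link (P1 ++ map (shift_calls (size P1)) P2) [::] env E.
  by rewrite cats0 -catA.
Qed.

Lemma polyt_link2 (A B1 B2 A2 : codeType) (f1 : A -> B1) (f2 : A2 -> B2) :
  polyt f1 -> polyt f2 ->
  exists P e1 e2 cost1 cost2, [/\ pbounded cost1, pbounded cost2,
    computed P e1 cost1 f1 & computed P e2 cost2 f2].
Proof.
move=> p1 p2.
have [P [e1 [_ [e2 [c1 [_ [c2 [[? _ ?] [? _ ?]]]]]]]]] := polyt_link3 p1 p1 p2.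
by exists P, e1, e2, c1, c2.
Qed.

Section Basic.
Variable A : codeType.

Lemma polyt_id : polyt (fun a : A => a).
Proof.
exists [::], (Var 0), (fun a => csize a); split; first exact: pbounded_vs.
by move=> a; exists (csize a) => //; constructor.
Qed.

(** Complexity depends on codes only; this transfers results between types with the same codes, such
    as [bool], [nat] and [int]. *)
Lemma polyt_recode (B C : codeType) (f : A -> B) (g : A -> C) :
  (forall a, enc (f a) = enc (g a)) -> polyt f -> polyt g.
Proof.
by move=> E [P [e [c [pc K]]]]; exists P, e, c; split=> // a; rewrite -E.
Qed.

Lemma polyt_ext (B : codeType) (f g : A -> B) : f =1 g -> polyt f -> polyt g.
Proof. by move=> E; apply: polyt_recode => a; rewrite E. Qed.

Lemma polyt_int (z : int) : polyt (fun _ : A => z).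
Proof.
exists [::], (Cst z), (fun a => csize z); split; first exact: pbounded_const.
by move=> a; exists (csize z) => //; constructor.
Qed.

Lemma polyt_nat (n : nat) : polyt (fun _ : A => n).
Proof. exact: polyt_recode (polyt_int n). Qed.

Lemma polyt_comp (B C : codeType) (g : B -> C) (f : A -> B) :
  polyt f -> polyt g -> polyt (fun a => g (f a)).
Proof.
move=> pf pg.
have [P [e1 [e2 [c1 [c2 [pc1 pc2 E1 E2]]]]]] := polyt_link2 pf pg.
exists P, (Let e1 e2), (fun a => c1 a + c2 (f a) + 1); split.
  exact: pbounded_add (pbounded_add pc1 (pbounded_polyt pf pc2)) (pbounded_const 1).
move=> a; have [c E le] := E1 a [::]; have [c' E' le'] := E2 (f a) [:: enc a].
by exists (c + c').+1; [apply: ELet E E' | lia].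
Qed.

Lemma polyt_pair (B C : codeType) (f : A -> B) (g : A -> C) :
  polyt f -> polyt g -> polyt (fun a => (f a, g a)).
Proof.
move=> pf pg.
have [P [e1 [e2 [c1 [c2 [pc1 pc2 E1 E2]]]]]] := polyt_link2 pf pg.
exists P, (Defs.Cons e1 e2), (fun a => c1 a + c2 a + (csize (f a) + csize (g a) + 1)); split.
  apply: pbounded_add; first exact: pbounded_add.
  exact: pbounded_add (pbounded_add (polyt_size pf) (polyt_size pg)) (pbounded_const 1).
move=> a; have [c E le] := E1 a [::]; have [c' E' le'] := E2 a [::].
exists (c + c' + (csize (f a) + csize (g a)).+1); last by lia.
exact: ECons E E'.
Qed.

Lemma polyt_if (B : codeType) (b : A -> bool) (f g : A -> B) :
  polyt b -> polyt f -> polyt g -> polyt (fun a => if b a then f a else g a).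
Proof.
move=> pif pf pg.
have [P [e1 [e2 [e3 [c1 [c2 [c3 [[p1 p2 p3] [E1 E2 E3]]]]]]]]] := polyt_link3 pif pf pg.
exists P, (If e1 e2 e3), (fun a => c1 a + (c2 a + c3 a) + 1); split.
  by do !apply: pbounded_add => //; apply: pbounded_const.
move=> a; have [c E le] := E1 a [::].
case: (b a) E => E.
  have [c' E' le'] := E2 a [::]; exists (c + c').+1; last by lia.
  exact: EIfT E _ E'.
have [c' E' le'] := E3 a [::]; exists (c + c').+1; last by lia.
exact: EIfF E E'.
Qed.

Lemma polyt_arith o (f g : A -> int) :
  pbounded (fun a => csize (arith o (f a) (g a))) ->
  polyt f -> polyt g -> polyt (fun a => arith o (f a) (g a)).
Proof.
move=> ps pf pg.
have [P [e1 [e2 [c1 [c2 [pc1 pc2 E1 E2]]]]]] := polyt_link2 pf pg.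
exists P, (Bin o e1 e2), (fun a => c1 a + c2 a + csize (arith o (f a) (g a))); split.
  by do !apply: pbounded_add.
move=> a; have [c E le] := E1 a [::]; have [c' E' le'] := E2 a [::].
exists (c + c' + csize (arith o (f a) (g a))); last by lia.
exact: EBin E E'.
Qed.

End Basic.

Lemma polyt_fst (A B C : codeType) (f : A -> B * C) :
  polyt f -> polyt (fun a => (f a).1).
Proof.
move=> [P [e [c [pc K]]]].
exists P, (Fst e), (fun a => c a + c a); split; first exact: pbounded_add.
move=> a; have [c' E le] := K a; exists (c' + csize (f a).1); first exact: EFst E.
by have := eval_size E; rewrite -/(csize (f a)); have := csize_fst (f a); lia.
Qed.

Lemma polyt_snd (A B C : codeType) (f : A -> B * C) :
  polyt f -> polyt (fun a => (f a).2).
Proof.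
move=> [P [e [c [pc K]]]].
exists P, (Snd e), (fun a => c a + c a); split; first exact: pbounded_add.
move=> a; have [c' E le] := K a; exists (c' + csize (f a).2); first exact: ESnd E.
by have := eval_size E; rewrite -/(csize (f a)); have := csize_snd (f a); lia.
Qed.

Lemma csize_split_le (A : codeType) (s1 s2 : seq A) x :
  csize x <= csize (s1 ++ x :: s2) /\ csize s2 <= csize (s1 ++ x :: s2).
Proof. by have := csize_cat s1 (x :: s2); rewrite csize_cons; have := csize_gt1 s1; lia. Qed.

(** * Loops over lists *)

(** A tail-recursive loop meant to be function 0, with argument (parameter, (remaining list,
    accumulator)). The [Let] rebuilds the argument that [step] expects, (parameter, (accumulator,
    element)). *)
Definition fold_body (step : expr) : expr :=
  let env := Fst (Var 0) in
  let l := Fst (Snd (Var 0)) in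
  let acc := Snd (Snd (Var 0)) in
  If (IsPair l)
     (Call 0 (Defs.Cons env (Defs.Cons (Snd l)
       (Let (Defs.Cons env (Defs.Cons acc (Fst l))) step))))
     acc.

(** [N] bounds the arguments of all recursive calls and [K] the costs of all steps along the loop;
    the factor 30 pays for the boundedly many copies of the argument made in one round. *)
Lemma fold_eval (A B C : codeType) (f : A -> C -> B -> C) P e cost
    (a : A) (l : seq B) (z : C) (N K : nat) :
  computed P e cost (fun p : A * (C * B) => f p.1 p.2.1 p.2.2) ->
  onth P 0 = Some (fold_body e) ->
  (forall s1 s2, l = s1 ++ s2 -> csize (a, (s2, foldl (f a) z s1)) <= N) ->
  (forall s1 x s2, l = s1 ++ x :: s2 -> cost (a, (foldl (f a) z s1, x)) <= K) ->
  exists2 c, eval P [:: enc (a, (l, z))] (fold_body e) (enc (foldl (f a) z l)) c &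
             c <= (size l).+1 * (30 * N + K + 30).
Proof.
move=> comp bodyP.
have parts (l' : seq B) (z' : C) : [/\ eval P [:: enc (a, (l', z'))] (Fst (Var 0)) (enc a)
                         (csize (a, (l', z')) + csize a),
    eval P [:: enc (a, (l', z'))] (Fst (Snd (Var 0))) (enc l')
      (csize (a, (l', z')) + csize (l', z') + csize l') &
    eval P [:: enc (a, (l', z'))] (Snd (Snd (Var 0))) (enc z')
      (csize (a, (l', z')) + csize (l', z') + csize z')].
  have E0 : eval P [:: enc (a, (l', z'))] (Var 0) (enc (a, (l', z'))) (csize (a, (l', z'))).
    exact: EVar.
  by split; [exact: EFst E0 | exact: EFst (ESnd E0) | exact: ESnd (ESnd E0)].
elim: l z => [|x l IH] z leN leK /=.
  have := leN [::] [::] erefl; rewrite !csize_pair /= => h.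
  have [_ El Ez] := parts [::] z.
  eexists; first by apply: EIfF Ez; apply: EIsPairF El.
  by rewrite /= trunc_log0 !csize_pair; have := csize_gt1 z; nia.
have h0 := leN [::] (x :: l) erefl; have h1 := leN [:: x] l erefl.
have h2 := leK [::] x l erefl.
rewrite /= in h0 h1 h2.
have [c2 E2 le2] := comp (a, (z, x)) [:: enc (a, (x :: l, z))].
have [|s1 y s2 E|c3 E3 le3] := IH (f a z x).
- by move=> s1 s2 E; apply: (leN (x :: s1)); rewrite E.
- by apply: (leK (x :: s1) _ s2); rewrite E.
have [Ee El Ez] := parts (x :: l) z.
eexists.
  apply: EIfT (EIsPairT El) _ (ECall _ bodyP E3) => //.
  exact: ECons Ee (ECons (ESnd El) (ELet (ECons Ee (ECons Ez (EFst El))) E2)).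
have -> : vsize (Int 1) = 2 by rewrite /= trunc_log1.
rewrite /= -!/(csize _) !csize_pair !csize_cons in h0 h1 le2 le3 *.
rewrite -!/(enc _) -!/(csize _).
repeat match goal with |- context [vsize ?t] => change (vsize t) with (csize l) end.
rewrite mulSn; lia.
Qed.

Lemma pbounded_exp (A : codeType) (F : A -> nat) d : pbounded F -> pbounded (fun a => F a ^ d).
Proof.
move=> [d' H]; exists (d' * d) => a; rewrite expnM.
by have [->|d0] := posnP d; [rewrite !expn0 | rewrite leq_exp2r].
Qed.

(** Iterating a polynomial-time step may blow up the accumulator exponentially, for instance by
    repeated squaring; hence the bound [F] on all intermediate accumulators. *)
Lemma polyt_foldl (A B C : codeType) (f : A -> C -> B -> C) (z : A -> C) (l : A -> seq B)
    (F : A -> nat) :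
  polyt l -> polyt z -> polyt (fun p : A * (C * B) => f p.1 p.2.1 p.2.2) -> pbounded F ->
  (forall a s1 s2, l a = s1 ++ s2 -> csize (foldl (f a) (z a) s1) <= F a) ->
  polyt (fun a => foldl (f a) (z a) (l a)).
Proof.
move=> pl pz [Ps [es [costs [[d pcosts] Es]]]] pF leF.
have [P [el [ez [cl [cz [pcl pcz El Ez]]]]]] := polyt_link2 pl pz.
(* The loop calls itself by the index 0, so it has to come first, and the code of the step moves by
   one. *)
pose Q := fold_body (shift_calls 1 es) :: map (shift_calls 1) Ps.
pose N a := csize a + (csize (l a) + F a).+2.
pose K a := N a ^ d.
pose e := Call 0 (Defs.Cons (Var 0)
  (Defs.Cons (shift_calls (size Q) el) (shift_calls (size Q) ez))).
exists (Q ++ map (shift_calls (size Q)) P), e.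
exists (fun a => cl a + cz a + (4 * N a + 1) + (csize (l a) + 1) * (30 * N a + K a + 30)).
have pl' := polyt_size pl.
have pN : pbounded N.
  apply: pbounded_le (pbounded_add pbounded_vs
    (pbounded_add (pbounded_add pl' pF) (pbounded_const 2))) => a.
  by rewrite /N addn2.
split.
  apply: pbounded_add (pbounded_mul (pbounded_add pl' (pbounded_const 1)) _).
    apply: pbounded_add (pbounded_add (pbounded_mul (pbounded_const 4) pN) (pbounded_const 1)).
    exact: pbounded_add.
  apply: pbounded_add (pbounded_const 30).
  exact: pbounded_add (pbounded_mul (pbounded_const 30) pN) (pbounded_exp d pN).
have comp : computed (Q ++ map (shift_calls (size Q)) P) (shift_calls 1 es) costs
    (fun p : A * (C * B) => f p.1 p.2.1 p.2.2).
  move=> a env; have [c E le] := Es a; exists c => //.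
  exact: (eval_link [:: fold_body (shift_calls 1 es)] (map (shift_calls (size Q)) P) env E).
move=> a; have [c1 E1 le1] := El a [::]; have [c2 E2 le2] := Ez a [::].
have zF := leF a [::] (l a) erefl.
have [|s1 x s2 E|c3 E3 le3] :=
  fold_eval (z := z a) (N := N a) (K := K a) (a := a) (l := l a) comp erefl.
- move=> s1 s2 E; have := leF a _ _ E; have := csize_cat s1 s2; rewrite -E /N.
  by have := csize_gt1 s1; rewrite !csize_pair; lia.
- apply: leq_trans (pcosts _) _; rewrite /K.
  have [->|d0] := posnP d; first by rewrite !expn0.
  rewrite leq_exp2r // /N !csize_pair.
  by have := leF a _ _ E; have [] := csize_split_le s1 s2 x; rewrite -E; lia.
have E12 : eval (Q ++ map (shift_calls (size Q)) P) [:: enc a]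
    (Defs.Cons (shift_calls (size Q) el) (shift_calls (size Q) ez))
    (enc (l a, z a)) (c1 + c2 + csize (l a, z a)).
  have := eval_link Q [::] [::] E1; have := eval_link Q [::] [::] E2.
  by rewrite !cats0 => E2' E1'; apply: ECons E1' E2'.
have E0 : eval (Q ++ map (shift_calls (size Q)) P) [:: enc a]
    (Defs.Cons (Var 0) (Defs.Cons (shift_calls (size Q) el) (shift_calls (size Q) ez)))
    (enc (a, (l a, z a))) (csize a + (c1 + c2 + csize (l a, z a)) + csize (a, (l a, z a))).
  by apply: ECons E12; apply: EVar.
exists (csize a + (c1 + c2 + csize (l a, z a)) + csize (a, (l a, z a)) + c3).+1.
  exact: ECall E0 _ E3.
rewrite !csize_pair.
have h := csize_size (l a); rewrite /= in zF.
have lm : (size (l a)).+1 * (30 * N a + K a + 30) <= (csize (l a) + 1) * (30 * N a + K a + 30).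
  by rewrite leq_mul2r addn1 ltnS h orbT.
move: (_ * (30 * N a + K a + 30)) (_ * (30 * N a + K a + 30)) lm le3 => X Y lm le3.
rewrite /N.
lia.
Qed.

(** The usual way to bound the accumulator: if no step adds more than [G a] to its size, then it
    grows only linearly in the number of rounds. *)
Lemma polyt_foldl_add (A B C : codeType) (f : A -> C -> B -> C) (z : A -> C) (l : A -> seq B)
    (G : A -> nat) :
  polyt l -> polyt z -> polyt (fun p : A * (C * B) => f p.1 p.2.1 p.2.2) -> pbounded G ->
  (forall a s1 x s2 acc, l a = s1 ++ x :: s2 -> csize (f a acc x) <= csize acc + G a) ->
  polyt (fun a => foldl (f a) (z a) (l a)).
Proof.
move=> pl pz pf pG leG.
apply: (@polyt_foldl _ _ _ _ _ _ (fun a => csize (z a) + csize (l a) * G a)) => //.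
  exact: pbounded_add (polyt_size pz) (pbounded_mul (polyt_size pl) pG).
move=> a s1 s2 E.
have : size s1 <= csize (l a) by have := csize_size (l a); rewrite {1}E size_cat; lia.
move=> le1; apply: (@leq_trans (csize (z a) + size s1 * G a)); last first.
  by rewrite leq_add2l leq_mul2r le1 orbT.
elim/last_ind: s1 s2 E {le1} => [|s x IH] s2; first by rewrite addn0.
rewrite cat_rcons => E; rewrite foldl_rcons size_rcons mulSn.
by have := leG a _ _ _ (foldl (f a) (z a) s) E; have := IH _ E; lia.
Qed.

(** * Sizes of integers and arithmetic *)

Lemma trunc_log_le n m : n < 2 ^ m.+1 -> trunc_log 2 n <= m.
Proof.
case: n => [|n] H; first by rewrite trunc_log0.
rewrite -ltnS -(ltn_exp2l _ _ (isT : 1 < 2)); apply: leq_ltn_trans H.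
exact: trunc_logP.
Qed.

Lemma csize_int (z : int) m : `|z| < 2 ^ m.+1 -> csize z <= m.+2.
Proof. by move=> /trunc_log_le; rewrite /csize /=. Qed.

Lemma csize_intK (z : int) : exists2 m, csize z = m.+2 & `|z| < 2 ^ m.+1.
Proof. by exists (trunc_log 2 `|z|) => //; apply: trunc_log_ltn. Qed.

(** The constant 2 in the size of each summand leaves room for the carry. *)
Lemma csize_addz (a b : int) : csize (a + b)%R <= csize a + csize b.
Proof.
have [m -> H] := csize_intK a; have [n -> K] := csize_intK b.
have -> : m.+2 + n.+2 = (m + n).+4 by lia.
apply: leq_trans (csize_int (m := (m + n).+1) _) _; last by lia.
apply: (@leq_ltn_trans (`|a| + `|b|)); first by lia.
have H1 : 2 ^ m.+1 <= 2 ^ (m + n).+1 by rewrite leq_exp2l //; lia.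
have H2 : 2 ^ n.+1 <= 2 ^ (m + n).+1 by rewrite leq_exp2l //; lia.
by rewrite [in ltnRHS]expnS; lia.
Qed.

Lemma csize_oppz (a : int) : csize (- a)%R = csize a.
Proof. by rewrite /csize /= abszN. Qed.

Lemma csize_subz (a b : int) : csize (a - b)%R <= csize a + csize b.
Proof. by rewrite -(csize_oppz b) csize_addz. Qed.

Lemma csize_mulz (a b : int) : csize (a * b)%R <= csize a + csize b.
Proof.
have [m -> H] := csize_intK a; have [n -> K] := csize_intK b.
have -> : m.+2 + n.+2 = (m + n).+4 by lia.
apply: leq_trans (csize_int (m := (m + n).+1) _) _; last by lia.
rewrite abszM -addnS -addSn expnD; exact: ltn_mul.
Qed.

Lemma csize_divz (a b : int) : csize (a %/ b)%Z <= csize a.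
Proof.
have [m -> H] := csize_intK a; apply: csize_int; apply: leq_ltn_trans H.
by have [->|b0] := eqVneq b 0%R; [rewrite divz0 | nia].
Qed.

Section Arith.
Variable A : codeType.
Implicit Types f g : A -> int.

Lemma polyt_addz f g : polyt f -> polyt g -> polyt (fun a => f a + g a)%R.
Proof.
move=> pf pg; apply: (polyt_arith (o := Defs.Add) (f := f) (g := g)) => //.
exact: pbounded_le (fun a => csize_addz _ _) (pbounded_add (polyt_size pf) (polyt_size pg)).
Qed.

Lemma polyt_subz f g : polyt f -> polyt g -> polyt (fun a => f a - g a)%R.
Proof.
move=> pf pg; apply: (polyt_arith (o := Defs.Sub) (f := f) (g := g)) => //.
exact: pbounded_le (fun a => csize_subz _ _) (pbounded_add (polyt_size pf) (polyt_size pg)).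
Qed.

Lemma polyt_mulz f g : polyt f -> polyt g -> polyt (fun a => f a * g a)%R.
Proof.
move=> pf pg; apply: (polyt_arith (o := Defs.Mul) (f := f) (g := g)) => //.
exact: pbounded_le (fun a => csize_mulz _ _) (pbounded_add (polyt_size pf) (polyt_size pg)).
Qed.

Lemma polyt_divz f g : polyt f -> polyt g -> polyt (fun a => f a %/ g a)%Z.
Proof.
move=> pf pg; apply: (polyt_arith (o := Defs.Quo) (f := f) (g := g)) => //.
exact: pbounded_le (fun a => csize_divz _ _) (polyt_size pf).
Qed.

Lemma polyt_lez f g : polyt f -> polyt g -> polyt (fun a => (f a <= g a)%R).
Proof.
move=> pf pg.
apply: (polyt_recode (f := fun a => Posz (f a <= g a)%R)) => //.
apply: (polyt_arith (o := Defs.Leq) (f := f) (g := g)) => //.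
apply: pbounded_le (pbounded_const 2) => a; rewrite /arith.
by case: (_ <= _)%R; rewrite /csize /= ?trunc_log0 ?trunc_log1.
Qed.

Lemma polyt_ltz f g : polyt f -> polyt g -> polyt (fun a => (f a < g a)%R).
Proof.
move=> pf pg.
apply: (polyt_ext (f := fun a => (f a + 1 <= g a)%R)); first by move=> a; lia.
by apply: polyt_lez => //; apply: polyt_addz => //; apply: polyt_int.
Qed.

Lemma polyt_Posz (f : A -> nat) : polyt f -> polyt (fun a => Posz (f a)).
Proof. exact: polyt_recode. Qed.

Lemma polyt_leqn (f g : A -> nat) : polyt f -> polyt g -> polyt (fun a => f a <= g a).
Proof. by move=> /polyt_Posz pf /polyt_Posz pg; apply: polyt_lez pf pg. Qed.

Lemma polyt_bool (b : bool) : polyt (fun _ : A => b).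
Proof. exact: polyt_recode (polyt_int _ (Posz b)). Qed.

Lemma polyt_and (f g : A -> bool) : polyt f -> polyt g -> polyt (fun a => f a && g a).
Proof.
move=> pf pg; apply: (polyt_ext (f := fun a => if f a then g a else false)).
  by move=> a; case: (f a).
by apply: polyt_if => //; apply: polyt_bool.
Qed.

Lemma polyt_negb (f : A -> bool) : polyt f -> polyt (fun a => ~~ f a).
Proof.
move=> pf; apply: (polyt_ext (f := fun a => if f a then false else true)) => //.
by apply: polyt_if => //; apply: polyt_bool.
Qed.

Lemma polyt_eqn (f g : A -> nat) : polyt f -> polyt g -> polyt (fun a => f a == g a).
Proof.
move=> pf pg; apply: (polyt_ext (f := fun a => (f a <= g a) && (g a <= f a))).
  by move=> a; rewrite eqn_leq.
by apply: polyt_and; apply: polyt_leqn.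
Qed.

Lemma polyt_succn (f : A -> nat) : polyt f -> polyt (fun a => (f a).+1).
Proof.
move=> pf; apply: (polyt_recode (f := fun a => (Posz (f a) + 1)%R)).
  by move=> a; rewrite -PoszD addn1.
by apply: polyt_addz; [apply: polyt_Posz | apply: polyt_int].
Qed.

Lemma polyt_predn (f : A -> nat) : polyt f -> polyt (fun a => (f a).-1).
Proof.
move=> pf.
apply: (polyt_recode (f := fun a => if f a <= 0 then 0%R else (Posz (f a) - 1)%R)).
  by move=> a; case: (f a) => [|n] //=; congr Int; lia.
apply: polyt_if; first by apply: polyt_leqn pf (polyt_nat _ _).
  exact: polyt_int.
by apply: polyt_subz; [apply: polyt_Posz | apply: polyt_int].
Qed.

Lemma polyt_Some (B : codeType) (f : A -> B) : polyt f -> polyt (fun a => Some (f a)).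
Proof.
move=> pf; apply: (polyt_recode (f := fun a => (1%R : int, f a))) => //.
by apply: polyt_pair => //; apply: polyt_int.
Qed.

Lemma polyt_None (B : codeType) : polyt (fun _ : A => @None B).
Proof. exact: polyt_recode (polyt_int _ 0%R). Qed.

Lemma polyt_nil (B : codeType) : polyt (fun _ : A => @nil B).
Proof. exact: polyt_recode (polyt_int _ 0%R). Qed.

Lemma polyt_cons (B : codeType) (f : A -> B) (s : A -> seq B) :
  polyt f -> polyt s -> polyt (fun a => f a :: s a).
Proof.
by move=> pf ps; apply: (polyt_recode (f := fun a => (f a, s a))) => //; apply: polyt_pair.
Qed.

End Arith.

(** * List functions *)

(** An element is no larger than its list, so a bound per element becomes a bound in terms of [a]
    that serves all rounds of a loop. *)
Lemma pbounded_mem (A B : codeType) (l : A -> seq B) (F : A * B -> nat) :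
  pbounded (fun a => csize (l a)) -> pbounded F ->
  exists2 G, pbounded G & forall a s1 x s2, l a = s1 ++ x :: s2 -> F (a, x) <= G a.
Proof.
move=> pl [d Hd]; exists (fun a => (csize a + csize (l a) + 1) ^ d).
  exact: pbounded_exp (pbounded_add (pbounded_add pbounded_vs pl) (pbounded_const 1)).
move=> a s1 x s2 E; apply: leq_trans (Hd _) _.
have [->|d0] := posnP d; first by rewrite !expn0.
by rewrite leq_exp2r // csize_pair; have [] := csize_split_le s1 s2 x; rewrite -E; lia.
Qed.

Lemma polyt_catrev (A B : codeType) (s t : A -> seq B) :
  polyt s -> polyt t -> polyt (fun a => catrev (s a) (t a)).
Proof.
move=> ps poly_time.
apply: (polyt_ext (f := fun a => foldl (fun acc x => x :: acc) (t a) (s a))).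
  by move=> a; elim: (s a) (t a) => //= x l IH u; rewrite IH.
apply: (@polyt_foldl_add _ _ _ _ _ _ (fun a => csize (s a) + 1)) => //.
- apply: polyt_cons; first by do !apply: polyt_snd; apply: polyt_id.
  by apply: polyt_fst; apply: polyt_snd; apply: polyt_id.
- exact: pbounded_add (polyt_size ps) (pbounded_const 1).
- by move=> a s1 x s2 acc ->; rewrite csize_cons; have [] := csize_split_le s1 s2 x; lia.
Qed.

Lemma polyt_rev (A B : codeType) (s : A -> seq B) : polyt s -> polyt (fun a => rev (s a)).
Proof. by move=> ps; apply: polyt_catrev => //; apply: polyt_nil. Qed.

Lemma polyt_cat (A B : codeType) (s t : A -> seq B) :
  polyt s -> polyt t -> polyt (fun a => s a ++ t a).
Proof.
move=> ps poly_time; apply: (polyt_ext (f := fun a => catrev (rev (s a)) (t a))).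
  by move=> a; rewrite catrevE revK.
by apply: polyt_catrev => //; apply: polyt_rev.
Qed.

Lemma polyt_map (A B C : codeType) (f : A -> B -> C) (l : A -> seq B) :
  polyt l -> polyt (fun p : A * B => f p.1 p.2) -> polyt (fun a => map (f a) (l a)).
Proof.
move=> pl pf.
apply: (polyt_ext (f := fun a => rev (foldl (fun acc x => f a x :: acc) [::] (l a)))).
  move=> a; rewrite -[RHS]revK -map_rev; congr rev.
  by rewrite -[l a]revK foldl_rev revK; elim: (rev _) => //= x s ->.
have [G pG leG] := pbounded_mem (polyt_size pl) (polyt_size pf).
have [pa pacc] : polyt (fun p : A * (seq C * B) => (p.1, p.2.2)) /\
    polyt (fun p : A * (seq C * B) => p.2.1).
  split; last by apply: polyt_fst; apply: polyt_snd; apply: polyt_id.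
  by apply: polyt_pair; [apply: polyt_fst | do !apply: polyt_snd]; apply: polyt_id.
have pc := polyt_comp pa pf.
have := @polyt_foldl_add _ _ _ (fun a acc x => f a x :: acc) (fun=> [::]) l
  (fun a => G a + 1) pl (polyt_nil _ _) (polyt_cons pc pacc)
  (pbounded_add pG (pbounded_const 1)).
move=> H; apply: polyt_rev; apply: H => a s1 x s2 acc /leG /=.
by rewrite csize_cons; lia.
Qed.

Lemma polyt_filter (A B : codeType) (f : A -> B -> bool) (l : A -> seq B) :
  polyt l -> polyt (fun p : A * B => f p.1 p.2) -> polyt (fun a => filter (f a) (l a)).
Proof.
move=> pl pf.
apply: (polyt_ext (f := fun a =>
    rev (foldl (fun acc x => if f a x then x :: acc else acc) [::] (l a)))).
  move=> a; rewrite -[RHS]revK -filter_rev; congr rev.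
  by rewrite -[l a]revK foldl_rev revK; elim: (rev _) => //= x s ->.
have [pa pacc] : polyt (fun p : A * (seq B * B) => (p.1, p.2.2)) /\
    polyt (fun p : A * (seq B * B) => p.2.1).
  split; last by apply: polyt_fst; apply: polyt_snd; apply: polyt_id.
  by apply: polyt_pair; [apply: polyt_fst | do !apply: polyt_snd]; apply: polyt_id.
have pc := polyt_comp pa pf.
have px := polyt_snd pa.
apply: polyt_rev.
apply: (@polyt_foldl_add _ _ _ _ _ _ (fun a => csize (l a) + 1) pl (polyt_nil _ _)).
- exact: polyt_if pc (polyt_cons px pacc) pacc.
- exact: pbounded_add (polyt_size pl) (pbounded_const 1).
- move=> a s1 x s2 acc ->; have [h _] := csize_split_le s1 s2 x.
  by case: ifP => _; rewrite ?csize_cons; lia.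
Qed.

Lemma polyt_flatten (A B : codeType) (l : A -> seq (seq B)) :
  polyt l -> polyt (fun a => flatten (l a)).
Proof.
move=> pl; apply: (polyt_ext (f := fun a => foldl cat [::] (l a))).
  by move=> a; rewrite -[RHS]cat0s; elim: (l a) [::] => [|x s IH] acc /=;
     rewrite ?cats0 // IH catA.
apply: (@polyt_foldl_add _ _ _ _ _ _ (fun a => csize (l a)) pl (polyt_nil _ _)).
- apply: polyt_cat; last by do !apply: polyt_snd; apply: polyt_id.
  by apply: polyt_fst; apply: polyt_snd; apply: polyt_id.
- exact: polyt_size.
- move=> a s1 x s2 acc ->; have [h _] := csize_split_le s1 s2 x.
  by have := csize_cat acc x; lia.
Qed.

Lemma polyt_size_seq (A B : codeType) (l : A -> seq B) : polyt l -> polyt (fun a => size (l a)).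
Proof.
move=> pl; apply: (polyt_ext (f := fun a => foldl (fun n _ => n.+1) 0 (l a))).
  by move=> a; rewrite -[RHS]addn0; elim: (l a) 0 => //= x s IH n; rewrite IH addnS.
apply: (@polyt_foldl_add _ _ _ _ _ _ (fun=> 2) pl (polyt_nat _ _)).
- by apply: polyt_succn; apply: polyt_fst; apply: polyt_snd; apply: polyt_id.
- exact: pbounded_const.
- move=> a s1 x s2 n _; have := csize_addz (Posz n) 1.
  by rewrite -PoszD addn1 {3}/csize /= trunc_log1.
Qed.

(** A choice from a list of candidates as a loop, with [None] exactly when there is no candidate. *)
Lemma polyt_last_option (A B : codeType) (l : A -> seq B) :
  polyt l -> polyt (fun a => foldl (fun _ x => Some x) None (l a)).
Proof.
move=> pl; apply: (@polyt_foldl_add _ _ _ _ _ _ (fun a => csize (l a) + 4) pl (polyt_None _ _)).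
- by apply: polyt_Some; do !apply: polyt_snd; apply: polyt_id.
- exact: pbounded_add (polyt_size pl) (pbounded_const 4).
- move=> a s1 x s2 acc ->; have [h _] := csize_split_le s1 s2 x.
  by rewrite {1}/csize /= trunc_log1 -/(csize x); lia.
Qed.

Lemma polyt_nth (A B : codeType) (d : A -> B) (l : A -> seq B) (i : A -> nat) :
  polyt d -> polyt l -> polyt i -> polyt (fun a => nth (d a) (l a) (i a)).
Proof.
move=> pd pl pi.
(* The counter starts at [(i a).+1]: the value 1 marks the wanted element, and 0, a fixed point of
   [.-1], says that it has been passed. *)
pose st (q : nat * B) x := (q.1.-1, if q.1 == 1 then x else q.2).
apply: (polyt_ext (f := fun a => (foldl st ((i a).+1, d a) (l a)).2)).
  move=> a; have st0 s y : (foldl st (0, y) s).2 = y by elim: s.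
  elim: (l a) (i a) => [|x s IH] [|n] //=; first by rewrite st0.
  exact: IH.
apply: polyt_snd.
apply: (@polyt_foldl_add _ _ _ (fun=> st) (fun a => ((i a).+1, d a)) l (fun a => csize (l a)) pl).
- by apply: polyt_pair => //; apply: polyt_succn.
- have p1 : polyt (fun p : A * (nat * B * B) => p.2.1.1).
    by do 2!apply: polyt_fst; apply: polyt_snd; apply: polyt_id.
  apply: polyt_pair; first exact: polyt_predn.
  apply: polyt_if; first by apply: polyt_eqn => //; apply: polyt_nat.
    by do !apply: polyt_snd; apply: polyt_id.
  by apply: polyt_snd; apply: polyt_fst; apply: polyt_snd; apply: polyt_id.
- exact: polyt_size.
- move=> a s1 x s2 [n y] ->; have [h _] := csize_split_le s1 s2 x.
  rewrite /st /= !csize_pair.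
  have hn : csize n.-1 <= csize n by rewrite /csize /= !ltnS; apply: leq_trunc_log; lia.
  by case: ifP => _; lia.
Qed.

(* [iota] is unary: it is only polynomial in the length of a given list. *)
Lemma polyt_indices (A B : codeType) (l : A -> seq B) :
  polyt l -> polyt (fun a => iota 0 (size (l a))).
Proof.
move=> pl; pose st (q : nat * seq nat) (_ : B) := (q.1.+1, q.1 :: q.2).
have stE l0 : foldl st (0, [::]) l0 = (size l0, rev (iota 0 (size l0))).
  elim/last_ind: l0 => [|s x IH] //.
  by rewrite foldl_rcons IH /st /= size_rcons -{3}(addn1 (size s)) iotaD rev_cat.
apply: (polyt_ext (f := fun a => rev (foldl st (0, [::]) (l a)).2)).
  by move=> a; rewrite stE revK.
apply: polyt_rev; apply: polyt_snd.
pose F a := csize (l a) + 2 + (csize (l a) * (csize (l a) + 3) + 2) + 1.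
apply: (@polyt_foldl _ _ _ (fun=> st) (fun=> (0, [::])) l F pl).
- by apply: polyt_pair; [apply: polyt_nat | apply: polyt_nil].
- have p1 : polyt (fun p : A * (nat * seq nat * B) => p.2.1.1).
    by do 2!apply: polyt_fst; apply: polyt_snd; apply: polyt_id.
  apply: polyt_pair; first exact: polyt_succn.
  apply: polyt_cons => //.
  by apply: polyt_snd; apply: polyt_fst; apply: polyt_snd; apply: polyt_id.
- have pv := polyt_size pl.
  apply: pbounded_add (pbounded_const 1).
  apply: pbounded_add (pbounded_add pv (pbounded_const 2)) _.
  exact: pbounded_add (pbounded_mul pv (pbounded_add pv (pbounded_const 3))) (pbounded_const 2).
- move=> a s1 s2 E; rewrite stE csize_pair /F.
  have le1 : size s1 <= csize (l a) by have := csize_size (l a); rewrite {1}E size_cat; lia.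
  have vn n : csize n <= n + 2.
    rewrite /csize /= addn2 !ltnS; apply: trunc_log_le.
    by apply: (@leq_trans (2 ^ n)); [exact: ltn_expl | rewrite leq_exp2l].
  have vl (s : seq nat) m : all (fun n => n <= m) s -> csize s <= size s * (m + 3) + 2.
    elim: s => [|x s IH] /=; first by rewrite csize_nil.
    by move=> /andP[xm /IH]; rewrite csize_cons mulSn; have := vn x; lia.
  have : csize (rev (iota 0 (size s1))) <= size s1 * (size s1 + 3) + 2.
    have := vl (rev (iota 0 (size s1))) (size s1).
    rewrite size_rev size_iota; apply.
    by rewrite all_rev; apply/allP => n; rewrite mem_iota; lia.
  have := vn (size s1); have : size s1 * (size s1 + 3) <= csize (l a) * (csize (l a) + 3).
    by rewrite leq_mul // leq_add2r.
  lia.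
Qed.

(** * The algorithm *)

Local Open Scope ring_scope.

Notation route := (seq (nat * int)).
Notation move := (nat * (nat * ((int * int) * (int * int))))%type.
Notation raw_instance := (seq (seq (nat * (int * int))) *
  (nat * (nat * seq (nat * (int * int)))))%type.
(* Adjacency lists with integer weights, source and target, and the homes and
   budgets of the agents. *)
Notation ctx := (seq route * ((nat * nat) * route))%type.
Notation guess := (nat * (nat * (nat * nat)))%type.

Definition rcost (r : route) : int := foldl (fun c e => c + e.2) 0 r.

Definition better (r1 r2 : route) : route := if rcost r1 <= rcost r2 then r1 else r2.

(* Bellman-Ford towards [v]; instead of being absent, the routes from vertices
   that do not reach [v] are bogus and cost at least [M]. *)
Definition bf_init (G : seq route) (M : int) (v : nat) : seq route :=
  [seq if x == v then [::] else [:: (0%N, M)] | x <- iota 0 (size G)].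

Definition bf_step (G row : seq route) : seq route :=
  [seq foldl (fun best e => better best (e :: nth [::] row e.1))
         (nth [::] row x) (nth [::] G x) | x <- iota 0 (size G)].

(** The list folded over serves as a counter: [size G] rounds. *)
Definition bf (G : seq route) (M : int) (v : nat) : seq route :=
  foldl (fun row _ => bf_step G row) (bf_init G M v) G.

Definition sp (G : seq route) (M : int) (u v : nat) : route := nth [::] (bf G M v) u.

(** A product instead of a least common multiple: its size is still at most about the sum of the
    sizes of the denominators. *)
Definition common_den (I : raw_instance) : int :=
  foldl (fun c q => c * q.2.2) 1 (flatten I.1 ++ I.2.2.2).

(** The quotient is exact when the denominator divides [D], see [scale_rat]. *)
Definition scale (D : int) (q : nat * (int * int)) : nat * int :=
  (q.1, (q.2.1 * D %/ q.2.2)%Z).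

Definition mkctx (I : raw_instance) : ctx :=
  ([seq [seq scale (common_den I) q | q <- l] | l <- I.1],
   ((I.2.1, I.2.2.1), [seq scale (common_den I) q | q <- I.2.2.2])).

Definition nagents (c : ctx) : nat := size c.2.2.
Definition home_of (c : ctx) (j : nat) : nat := (nth (0%N, 0) c.2.2 j).1.
Definition budget_of (c : ctx) (j : nat) : int := (nth (0%N, 0) c.2.2 j).2.
Definition max_budget (c : ctx) : int :=
  foldl (fun m e => if m <= e.2 then e.2 else m) 0 c.2.2.

(** With a bogus cost beyond all budgets, every distance up to [max_budget] is that of a genuine
    route, and no agent could afford a longer one. *)
Definition route_of (c : ctx) (u v : nat) : route := sp c.1 (max_budget c + 1) u v.
Definition dist (c : ctx) (u v : nat) : int := rcost (route_of c u v).
(** The closed tour from home through [q] and [x]. The leg from [x] to home is measured as a route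
    from home, and walked in reverse; the last agent, with [q] the target, walks the whole tour in
    the opposite sense. *)
Definition tour (c : ctx) (q j x : nat) : int :=
  dist c (home_of c j) q + dist c q x + dist c (home_of c j) x.

(** A guess has the form [(a, (x, (b, y)))], so [g.1] is the first agent, [g.2.1] its base,
    [g.2.2.1] the last agent and [g.2.2.2] its base. *)
Definition base (c : ctx) (g : guess) (j : nat) : nat :=
  if j == g.1 then g.2.1 else if j == g.2.2.1 then g.2.2.2 else home_of c j.

Definition residual (c : ctx) (g : guess) (j : nat) : int :=
  if j == g.1 then budget_of c j - tour c c.2.1.1 j g.2.1
  else if j == g.2.2.1 then budget_of c j - tour c c.2.1.2 j g.2.2.2
  else budget_of c j.

Definition adjacent (c : ctx) (g : guess) (i j : nat) : bool :=
  dist c (base c g i) (base c g j) * 2 <= residual c g i + residual c g j.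

Definition agent_graph (c : ctx) (g : guess) : seq route :=
  [seq [seq (j, 1) | j <- iota 0 (nagents c) & adjacent c g i j] | i <- iota 0 (nagents c)].

(** All edges have weight 1, and a simple path of agents has fewer than [nagents c] of them; so
    [nagents c] works as the bogus cost, and [good_guess] recognizes a genuine path by its smaller
    cost. *)
Definition team_route (c : ctx) (g : guess) : route :=
  sp (agent_graph c g) (nagents c) g.1 g.2.2.1.

Definition team (c : ctx) (g : guess) : seq nat := g.1 :: map fst (team_route c g).

Definition good_guess (c : ctx) (g : guess) : bool :=
  (~~ (g.1 == g.2.2.1)) && ((0 <= residual c g g.1) &&
  ((0 <= residual c g g.2.2.1) && (rcost (team_route c g) < nagents c))).

(* The state holds the two parts of the route, the current vertex, and the
   remaining length of the first part, which is negative once the cut point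
   has been passed; lengths are in units of [1 / c]. *)
Definition split_step (c : int) (st : (seq move * seq move) * (nat * int)) (e : nat * int) :=
  if st.2.2 < 0 then
    ((st.1.1, st.1.2 ++ [:: (st.2.1, (e.1, ((0, 1), (1, 1))))]), (e.1, -1))
  else if c * e.2 <= st.2.2 then
    ((st.1.1 ++ [:: (st.2.1, (e.1, ((0, 1), (1, 1))))], st.1.2), (e.1, st.2.2 - c * e.2))
  else
    ((st.1.1 ++ [:: (st.2.1, (e.1, ((0, 1), (st.2.2, c * e.2))))],
      st.1.2 ++ [:: (st.2.1, (e.1, ((st.2.2, c * e.2), (1, 1))))]), (e.1, -1)).

Definition split_route (c : int) (u : nat) (r : route) (len : int) : seq move * seq move :=
  (foldl (split_step c) (([::], [::]), (u, len)) r).1.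

Definition flip (ms : seq move) : seq move :=
  [seq (m.1, (m.2.1, (m.2.2.2, m.2.2.1))) | m <- rev ms].

(** Cutting a route at its full length turns all of it into moves. *)
Definition way (c : ctx) (u v : nat) : seq move :=
  (split_route 1 u (route_of c u v) (dist c u v)).1.

(* The [i.+1] is the rank of the [i]-th member, counted from 1; the length is in
   units of [1 / (2 k)] for [k] agents. *)
Definition link (c : ctx) (g : guess) (i : nat) : seq move * seq move :=
  split_route (nagents c * 2)
    (base c g (nth 0%N (team c g) i))
    (route_of c (base c g (nth 0%N (team c g) i)) (base c g (nth 0%N (team c g) i.+1)))
    (Posz (nagents c) * residual c g (nth 0%N (team c g) i) +
     (Posz (nagents c) - 2 * Posz i.+1) * max_budget c).

(** The walk of a member apart from the links consists of the part before its entry, the part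
    between entry and exit, walked with the message, and the part after its exit. For inner members
    all three are empty. *)
Definition before (c : ctx) (g : guess) (j : nat) : seq move :=
  if j == g.1 then way c (home_of c j) c.2.1.1
  else if j == g.2.2.1 then way c (home_of c j) g.2.2.2 else [::].

Definition between (c : ctx) (g : guess) (j : nat) : seq move :=
  if j == g.1 then way c c.2.1.1 g.2.1
  else if j == g.2.2.1 then flip (way c c.2.1.2 g.2.2.2) else [::].

Definition after (c : ctx) (g : guess) (j : nat) : seq move :=
  if j == g.1 then flip (way c (home_of c j) g.2.1)
  else if j == g.2.2.1 then flip (way c (home_of c j) c.2.1.2) else [::].

Definition walks (j : nat) (ms : seq move) : seq Defs.val := [seq enc (0%N, (j, m)) | m <- ms].

(** [B] leads from the place of pick-up to the entry and [A] from the exit to the place of drop.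
    Both are walked once without and once with the message, which is why link parts count twice. *)
Definition block (j : nat) (pre B mid A post : seq move) : seq Defs.val :=
  walks j (pre ++ flip B) ++ enc (1%N, j) :: walks j (B ++ mid ++ A) ++
  enc (2%N, j) :: walks j (flip A ++ post).

Definition member_block (c : ctx) (g : guess) (i : nat) : seq Defs.val :=
  let j := nth 0%N (team c g) i in
  block j (before c g j)
    (if (i <= 0)%N then [::] else (link c g i.-1).2) (between c g j)
    (if (i.+2 <= size (team c g))%N then (link c g i).1 else [::]) (after c g j).

Definition build (c : ctx) (g : guess) : seq Defs.val :=
  flatten [seq member_block c g i | i <- iota 0 (size (team c g))].

Definition solo_ok (c : ctx) (j : nat) : bool := tour c c.2.1.1 j c.2.1.2 <= budget_of c j.

Definition solo (c : ctx) (j : nat) : seq Defs.val :=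
  block j (way c (home_of c j) c.2.1.1) [::] (way c c.2.1.1 c.2.1.2) [::]
    (flip (way c (home_of c j) c.2.1.2)).

Definition guesses (c : ctx) : seq guess :=
  let ks := iota 0 (nagents c) in let ns := iota 0 (size c.1) in
  flatten [seq flatten [seq flatten [seq [seq (a, (x, (b, y))) | y <- ns]
    | b <- ks] | x <- ns] | a <- ks].

Definition solve (I : raw_instance) : option (seq Defs.val) :=
  let c := mkctx I in
  foldl (fun _ sol => Some sol) None
    ([seq solo c j | j <- iota 0 (nagents c) & solo_ok c j] ++
     [seq build c g | g <- guesses c & good_guess c g]).

(** * Running time *)

Local Open Scope nat_scope.

(** Syntax-directed proofs of [polyt], one rule per head symbol; [poly_time_user] is a hook that is
    redefined as further functions of the algorithm have been treated. *)
Ltac poly_time_user := fail.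
Ltac poly_time_step := first [ assumption
  | match goal with H : polyt ?f |- polyt (fun p => ?f (@?u p)) =>
      apply: (polyt_comp (f := u) (g := f)) end
  | lazymatch goal with
  | |- polyt (fun a => a) => exact: polyt_id
  | |- polyt (fun a => fst (@?f a)) => apply: (polyt_fst (f := f))
  | |- polyt (fun a => snd (@?f a)) => apply: (polyt_snd (f := f))
  | |- polyt (fun a => pair (@?f a) (@?g a)) => apply: (polyt_pair (f := f) (g := g))
  | |- polyt (fun a => @nil _) => exact: polyt_nil
  | |- polyt (fun a => cons (@?f a) (@?g a)) => apply: (polyt_cons (f := f) (s := g))
  | |- polyt (fun a => (@?f a - @?g a)%R) =>
      apply: (polyt_subz (f := f) (g := g))
  | |- polyt (fun a => (@?f a + @?g a)%R) => apply: (polyt_addz (f := f) (g := g))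
  | |- polyt (fun a => (@?f a * @?g a)%R) => apply: (polyt_mulz (f := f) (g := g))
  | |- polyt (fun a => divz (@?f a) (@?g a)) => apply: (polyt_divz (f := f) (g := g))
  | |- polyt (fun a => Order.le (@?f a) (@?g a)) => apply: (polyt_lez (f := f) (g := g))
  | |- polyt (fun a => Order.lt (@?f a) (@?g a)) => apply: (polyt_ltz (f := f) (g := g))
  | |- polyt (fun a => leq (@?f a) (@?g a)) => apply: (polyt_leqn (f := f) (g := g))
  | |- polyt (fun a => eq_op (@?f a) (@?g a)) => apply: (polyt_eqn (f := f) (g := g))
  | |- polyt (fun a => andb (@?f a) (@?g a)) => apply: (polyt_and (f := f) (g := g))
  | |- polyt (fun a => negb (@?f a)) => apply: (polyt_negb (f := f))
  | |- polyt (fun a => S (@?f a)) => apply: (polyt_succn (f := f))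
  | |- polyt (fun a => predn (@?f a)) => apply: (polyt_predn (f := f))
  | |- polyt (fun a => Posz (@?f a)) => apply: (polyt_Posz (f := f))
  | |- polyt (fun a => flatten (@?f a)) => apply: (polyt_flatten (l := f))
  | |- polyt (fun a => rev (@?f a)) => apply: (polyt_rev (s := f))
  | |- polyt (fun a => cat (@?f a) (@?g a)) => apply: (polyt_cat (s := f) (t := g))
  | |- polyt (fun a => nth (@?d a) (@?l a) (@?i a)) =>
      apply: (polyt_nth (d := d) (l := l) (i := i))
  | |- polyt (fun a => iota 0 (size (@?l a))) => apply: (polyt_indices (l := l))
  | |- polyt (fun a => size (@?l a)) => apply: (polyt_size_seq (l := l))
  | |- polyt (fun a => map (@?f a) (@?l a)) => apply: (polyt_map (f := f) (l := l))
  | |- polyt (fun a => filter (@?f a) (@?l a)) => apply: (polyt_filter (f := f) (l := l))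
  | _ => first [ poly_time_user | exact: polyt_nat | exact: polyt_int | apply: polyt_if ]
  end ].
Ltac poly_time := lazy beta; repeat (poly_time_step; lazy beta).

Lemma polyt_rcost (A : codeType) (f : A -> route) : polyt f -> polyt (fun a => rcost (f a)).
Proof.
move=> pf; rewrite /rcost.
apply: (@polyt_foldl_add _ _ _ _ _ _ (fun a => csize (f a)) pf); try by poly_time.
- exact: polyt_size.
- move=> a s1 x s2 acc ->; have [h _] := csize_split_le s1 s2 x.
  by apply: leq_trans (csize_addz _ _) _; rewrite leq_add2l; apply: leq_trans (csize_snd x) h.
Qed.

Lemma polyt_better (A : codeType) (f g : A -> route) : polyt f -> polyt g ->
  polyt (fun a => better (f a) (g a)).
Proof.
move=> pf pg; rewrite /better; have := polyt_rcost pf; have := polyt_rcost pg => ? ?.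
poly_time.
Qed.

Lemma csize_mem (s : route) x : x \in s -> csize x <= csize s.
Proof.
elim: s => //= y s IH; rewrite inE csize_cons => /orP[/eqP->|/IH]; lia.
Qed.

Lemma csize_nth (A : codeType) (s : seq A) i d : csize (nth d s i) <= csize s + csize d.
Proof. by elim: s i => [|x s IH] [|i] //=; rewrite ?csize_cons; [lia..|have := IH i; lia]. Qed.

Ltac poly_time_user ::= lazymatch goal with
  | |- polyt (fun a => rcost (@?f a)) => apply: (polyt_rcost (f := f))
  | |- polyt (fun a => better (@?f a) (@?g a)) => apply: (polyt_better (f := f) (g := g))
  end.

Lemma polyt_bf_init (A : codeType) (G : A -> seq route) M v : polyt G -> polyt M -> polyt v ->
  polyt (fun a => bf_init (G a) (M a) (v a)).
Proof. by move=> pG pM pv; rewrite /bf_init; poly_time. Qed.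

Definition bounded_row (m : nat) (row : seq route) := forall i, csize (nth [::] row i) <= m.

Lemma csize_bounded_row m row : bounded_row m row -> csize row <= size row * m.+1 + 2.
Proof.
elim: row => [|r row IH] H; first by rewrite csize_nil.
rewrite csize_cons /= mulSn; have := H 0; have := IH (fun i => H i.+1); rewrite /=; lia.
Qed.

Lemma bounded_map (f : nat -> route) m n : 2 <= m -> (forall x, x < n -> csize (f x) <= m) ->
  bounded_row m [seq f x | x <- iota 0 n].
Proof.
move=> m2 H i; have [lti|lei] := ltnP i n; last first.
  by rewrite nth_default ?size_map ?size_iota ?csize_nil.
by rewrite (nth_map 0) ?size_iota // nth_iota // H.
Qed.

Lemma bf_row_mem (G row : seq route) (l : route) (z : route) m :
  (forall e, e \in l -> csize e <= csize G) -> csize z <= m + csize G + 1 -> bounded_row m row ->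
  csize (foldl (fun best e => better best (e :: nth [::] row e.1)) z l) <= m + csize G + 1.
Proof.
move=> Hl; elim: l Hl z => [|e l IH] Hl z Hz Hrow //=; apply: IH => //.
  by move=> e' He'; apply: Hl; rewrite inE He' orbT.
rewrite /better; case: ifP => // _; rewrite csize_cons.
by have := Hl e (mem_head _ _); have := Hrow e.1; lia.
Qed.

Lemma csize_edge (G : seq route) i (e : nat * int) : e \in nth [::] G i -> csize e <= csize G.
Proof.
elim: G i => [|l G IH] [|i] //= H; rewrite csize_cons; last by have := IH i H; lia.
by have := csize_mem H; lia.
Qed.

(** A round puts at most one edge in front of an entry of the previous row, so entries grow by at
    most the size of an edge per round. *)
Lemma bounded_bf (G : seq route) M v (s : seq route) :
  let row := foldl (fun row (_ : route) => bf_step G row) (bf_init G M v) s in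
  bounded_row (csize M + 6 + size s * (csize G + 1)) row /\ size row = size G.
Proof.
elim/last_ind: s => [|s x [IH IHs]] /=.
  split; last by rewrite size_map size_iota.
  apply: bounded_map => [|x _]; first by have := csize_gt1 M; lia.
  by case: ifP => _; rewrite ?csize_cons ?csize_pair ?csize_nil ?{1}/csize /= ?trunc_log0; lia.
rewrite foldl_rcons size_rcons mulSn; split; last by rewrite size_map size_iota.
apply: bounded_map => [|y _]; first by have := csize_gt1 M; lia.
set m := csize M + 6 + size s * (csize G + 1) in IH.
apply: (@leq_trans (m + csize G + 1)); last by rewrite /m; lia.
apply: bf_row_mem => //; last by have := IH y; lia.
exact: csize_edge.
Qed.

Lemma polyt_sp (A : codeType) (G : A -> seq route) M u v :
  polyt G -> polyt M -> polyt u -> polyt v ->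
  polyt (fun a => sp (G a) (M a) (u a) (v a)).
Proof.
move=> pG pM pu pv; rewrite /sp; apply: polyt_nth => //; first by poly_time.
have pin := polyt_bf_init pG pM pv.
(* The size of a row: at most [csize (G a)] entries, each bounded as in [bounded_bf] after at most
   [csize (G a)] rounds. *)
pose F a := csize (G a) * (csize (M a) + 6 + csize (G a) * (csize (G a) + 1) + 1) + 2.
apply: (@polyt_foldl _ _ _ (fun a row _ => bf_step (G a) row) _ _ F) => //.
- rewrite /bf_step.
  apply: polyt_map; first by poly_time.
  lazy beta.
  pose f (p : A * (seq route * route) * nat) best e := better best (e :: nth [::] p.1.2.1 e.1).
  apply: (@polyt_foldl_add _ _ _ f (fun p => nth [::] p.1.2.1 p.2)
    (fun p => nth [::] (G p.1.1) p.2)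
    (fun p => csize (G p.1.1) + csize p.1.2.1 + 3)); try by poly_time.
  + apply: pbounded_add (pbounded_const 3); apply: pbounded_add.
      have : polyt (fun p : A * (seq route * route) * nat => G p.1.1) by poly_time.
      exact: polyt_size.
    have : polyt (fun p : A * (seq route * route) * nat => p.1.2.1) by poly_time.
    exact: polyt_size.
  + move=> p s1 x s2 acc E; rewrite /f /better; case: ifP => _; first by lia.
    have : x \in nth [::] (G p.1.1) p.2 by rewrite E mem_cat mem_head orbT.
    have : csize (@nth route [::] p.1.2.1 x.1) <= csize p.1.2.1 + 2.
      by apply: leq_trans (csize_nth _ _ _) _; rewrite csize_nil.
    have arith a b c d e : a <= b + 2 -> c <= d -> (c + a).+1 <= e + (d + b + 3) by lia.
    by move=> h /csize_edge; apply: arith h.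
- have [pG' pM'] := (polyt_size pG, polyt_size pM).
  rewrite /F; apply: pbounded_add (pbounded_const 2); apply: pbounded_mul => //.
  apply: pbounded_add (pbounded_const 1).
  by apply: pbounded_add (pbounded_add _ (pbounded_const _))
    (pbounded_mul _ (pbounded_add _ (pbounded_const _))).
- move=> a s1 s2 E; have := bounded_bf (G a) (M a) (v a) s1.
  case=> /csize_bounded_row + Es; rewrite Es => /leq_trans; apply.
  have le1 : size s1 <= csize (G a) by have := csize_size (G a); rewrite {1}E size_cat; lia.
  rewrite /F leq_add2r; apply: leq_mul; first exact: csize_size.
  by rewrite -addn1 leq_add2r leq_add2l leq_mul2r le1 orbT.
Qed.

Ltac poly_time_user1 := lazymatch goal with
  | |- polyt (fun a => rcost (@?f a)) => apply: (polyt_rcost (f := f))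
  | |- polyt (fun a => sp (@?G a) (@?M a) (@?u a) (@?v a)) =>
      apply: (polyt_sp (G := G) (M := M) (u := u) (v := v))
  end.
Ltac poly_time_user ::= poly_time_user1.

Lemma polyt_max_budget (A : codeType) (c : A -> ctx) :
  polyt c -> polyt (fun a => max_budget (c a)).
Proof.
move=> pc; rewrite /max_budget.
have pl : polyt (fun a => (c a).2.2) by poly_time.
apply: (@polyt_foldl_add _ _ _ _ _ _ (fun a => csize (c a).2.2) pl); try by poly_time.
  exact: polyt_size.
move=> a s1 x s2 acc ->; have [h _] := csize_split_le s1 s2 x.
by case: ifP => _; [apply: leq_trans (csize_snd x) (leq_trans h (leq_addl _ _)) | apply: leq_addr].
Qed.

Lemma polyt_common_den (A : codeType) (f : A -> raw_instance) :
  polyt f -> polyt (fun a => common_den (f a)).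
Proof.
move=> pf; rewrite /common_den.
have pl : polyt (fun a => flatten (f a).1 ++ (f a).2.2.2) by poly_time.
apply: (@polyt_foldl_add _ _ _ _ _ _ (fun a => csize (flatten (f a).1 ++ (f a).2.2.2)) pl);
  try by poly_time.
  exact: polyt_size.
move=> a s1 x s2 acc ->; have [h _] := csize_split_le s1 s2 x.
apply: leq_trans (csize_mulz _ _) _; rewrite leq_add2l; apply: leq_trans h.
exact: leq_trans (csize_snd x.2) (csize_snd x).
Qed.

Lemma csize_rcons (A : codeType) (s : seq A) x : csize (s ++ [:: x]) = csize s + csize x + 1.
Proof. by have := csize_cat s [:: x]; rewrite csize_cons csize_nil; lia. Qed.

(* The remaining length may be copied into two moves, but it is then reset to
   [-1]: its weight in the potential pays for the copies. *)
Lemma csize_split_step (c : int) st (e : nat * int) :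
  let phi st := csize st.1.1 + csize st.1.2 + 3 * csize st.2.1 + 4 * csize st.2.2 in
  phi (split_step c st e) <= phi st + (4 * csize c + 8 * csize e + 100).
Proof.
case: st => [[X Y] [u r]]; case: e => x w /=; rewrite /split_step /=.
have v0 : csize (0 : int)%R = 2 by rewrite /csize /= trunc_log0.
have v1 : csize (1 : int)%R = 2 by rewrite /csize /= trunc_log1.
have vN1 : csize (-1 : int)%R = 2 by rewrite /csize /= trunc_log1.
have hs := csize_subz r (c * w)%R; have hm := csize_mulz c w.
have hr := csize_gt1 r.
by case: ifP => _; [|case: ifP => _]; rewrite /= ?vN1 ?csize_rcons !csize_pair ?v0 ?v1; lia.
Qed.

Lemma polyt_split_route (A : codeType) (c : A -> int) u r len :
  polyt c -> polyt u -> polyt r -> polyt len ->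
  polyt (fun a => split_route (c a) (u a) (r a) (len a)).
Proof.
move=> pc pu pr plen; apply: polyt_fst.
pose phi (st : (seq move * seq move) * (nat * int)) :=
  csize st.1.1 + csize st.1.2 + 3 * csize st.2.1 + 4 * csize st.2.2.
pose K a := 4 * csize (c a) + 8 * csize (r a) + 100.
pose F a := 4 + 3 * csize (u a) + 4 * csize (len a) + csize (r a) * K a + 3.
have [pc' pu' pr' pl'] := And4 (polyt_size pc) (polyt_size pu) (polyt_size pr) (polyt_size plen).
have pK : pbounded K.
  apply: pbounded_add (pbounded_const 100).
  exact: pbounded_add (pbounded_mul (pbounded_const 4) pc') (pbounded_mul (pbounded_const 8) pr').
have pF : pbounded F.
  rewrite /F; apply: pbounded_add (pbounded_const 3); apply: pbounded_add (pbounded_mul pr' pK).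
  apply: pbounded_add (pbounded_mul (pbounded_const 4) pl').
  exact: pbounded_add (pbounded_const 4) (pbounded_mul (pbounded_const 3) pu').
apply: (@polyt_foldl _ _ _ _ _ _ F pr _ _ pF).
- by poly_time.
- by rewrite /split_step; poly_time.
- move=> a s1 s2 E.
  have le1 : size s1 <= csize (r a) by have := csize_size (r a); rewrite {1}E size_cat; lia.
  suff H : phi (foldl (split_step (c a)) ([::], [::], (u a, len a)) s1) <=
      4 + 3 * csize (u a) + 4 * csize (len a) + size s1 * K a.
    apply: (@leq_trans (4 + 3 * csize (u a) + 4 * csize (len a) + size s1 * K a + 3)); last first.
      by rewrite /F leq_add2r leq_add2l leq_mul2r le1 orbT.
    move: H; move: (foldl _ _ _) => [[X Y] [v l]]; rewrite /phi !csize_pair /=.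
    by have := csize_gt1 v; have := csize_gt1 l; lia.
  elim/last_ind: s1 s2 E {le1} => [|s x IH] s2.
    by rewrite /phi /= !csize_nil; lia.
  rewrite cat_rcons => E; rewrite foldl_rcons size_rcons (mulSn (size s)).
  have [hx _] := csize_split_le s s2 x; rewrite -E in hx.
  have := IH _ E; move: (foldl _ _ _) => st Hst.
  apply: leq_trans (csize_split_step _ _ _) _; rewrite -/(phi st).
  apply: leq_trans (leq_add Hst (leqnn _)) _.
  have arith p q k k' : k <= k' -> p + q + k <= p + (k' + q) by lia.
  by apply: arith; rewrite /K leq_add2r leq_add2l leq_mul2l hx orbT.
Qed.

Ltac poly_time_user2 := lazymatch goal with
  | |- polyt (fun a => max_budget (@?c a)) => apply: (polyt_max_budget (c := c))
  | |- polyt (fun a => common_den (@?f a)) => apply: (polyt_common_den (f := f))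
  | |- polyt (fun a => split_route (@?c a) (@?u a) (@?r a) (@?l a)) =>
      apply: (polyt_split_route (c := c) (u := u) (r := r) (len := l))
  end.
Ltac poly_time_user ::= first [poly_time_user1 | poly_time_user2].

Section Accessors.
Variables (A : codeType) (c : A -> ctx) (j u v : A -> nat).
Hypotheses (pc : polyt c) (pj : polyt j) (pu : polyt u) (pv : polyt v).

Lemma polyt_mkctx (f : A -> raw_instance) : polyt f -> polyt (fun a => mkctx (f a)).
Proof. by move=> pf; rewrite /mkctx /scale; poly_time. Qed.

Lemma polyt_nagents : polyt (fun a => nagents (c a)).
Proof. by rewrite /nagents; poly_time. Qed.

Lemma polyt_home : polyt (fun a => home_of (c a) (j a)).
Proof. by rewrite /home_of; poly_time. Qed.

Lemma polyt_budget : polyt (fun a => budget_of (c a) (j a)).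
Proof. by rewrite /budget_of; poly_time. Qed.

Lemma polyt_route_of : polyt (fun a => route_of (c a) (u a) (v a)).
Proof. by rewrite /route_of; poly_time. Qed.

Lemma polyt_dist : polyt (fun a => dist (c a) (u a) (v a)).
Proof. by rewrite /dist /route_of; poly_time. Qed.

Lemma polyt_flip (m : A -> seq move) : polyt m -> polyt (fun a => flip (m a)).
Proof. by move=> pm; rewrite /flip; poly_time. Qed.

Lemma polyt_walks (m : A -> seq move) : polyt m -> polyt (fun a => walks (j a) (m a)).
Proof.
move=> pm; rewrite /walks; apply: polyt_map => //.
apply: (polyt_recode (f := fun p : A * move => (0, (j p.1, p.2)))) => //.
by poly_time.
Qed.

Lemma polyt_action (n : nat) : polyt (fun a => enc (n, j a) : Defs.val).
Proof. by apply: (polyt_recode (f := fun a => (n, j a))) => //; poly_time. Qed.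

End Accessors.

Ltac poly_time_user3 := lazymatch goal with
  | |- polyt (fun a => mkctx (@?f a)) => apply: (polyt_mkctx (f := f))
  | |- polyt (fun a => nagents (@?c a)) => apply: (polyt_nagents (c := c))
  | |- polyt (fun a => home_of (@?c a) (@?j a)) => apply: (polyt_home (c := c) (j := j))
  | |- polyt (fun a => budget_of (@?c a) (@?j a)) => apply: (polyt_budget (c := c) (j := j))
  | |- polyt (fun a => route_of (@?c a) (@?u a) (@?v a)) =>
      apply: (polyt_route_of (c := c) (u := u) (v := v))
  | |- polyt (fun a => dist (@?c a) (@?u a) (@?v a)) =>
      apply: (polyt_dist (c := c) (u := u) (v := v))
  | |- polyt (fun a => flip (@?m a)) => apply: (polyt_flip (m := m))
  | |- polyt (fun a => walks (@?j a) (@?m a)) => apply: (polyt_walks (j := j) _ (m := m))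
  | |- polyt (fun a => enc (?n, @?j a)) => apply: (polyt_action (j := j) _ n)
  end.
Ltac poly_time_user ::= first [poly_time_user1 | poly_time_user2 | poly_time_user3].

Section Residuals.
Variables (A : codeType) (c : A -> ctx) (g : A -> guess) (j u v : A -> nat).
Hypotheses (pc : polyt c) (pg : polyt g) (pj : polyt j) (pu : polyt u) (pv : polyt v).

Lemma polyt_tour : polyt (fun a => tour (c a) (u a) (j a) (v a)).
Proof. by rewrite /tour; poly_time. Qed.

Lemma polyt_base : polyt (fun a => base (c a) (g a) (j a)).
Proof. by rewrite /base; poly_time. Qed.

Lemma polyt_residual : polyt (fun a => residual (c a) (g a) (j a)).
Proof. by rewrite /residual /tour; poly_time. Qed.

Lemma polyt_way : polyt (fun a => way (c a) (u a) (v a)).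
Proof. by rewrite /way; poly_time. Qed.

End Residuals.

Ltac poly_time_user4 := lazymatch goal with
  | |- polyt (fun a => tour (@?c a) (@?u a) (@?j a) (@?v a)) =>
      apply: (polyt_tour (c := c) (u := u) (j := j) (v := v))
  | |- polyt (fun a => base (@?c a) (@?g a) (@?j a)) =>
      apply: (polyt_base (c := c) (g := g) (j := j))
  | |- polyt (fun a => residual (@?c a) (@?g a) (@?j a)) =>
      apply: (polyt_residual (c := c) (g := g) (j := j))
  | |- polyt (fun a => way (@?c a) (@?u a) (@?v a)) =>
      apply: (polyt_way (c := c) (u := u) (v := v))
  end.
Ltac poly_time_user ::=
  first [poly_time_user1 | poly_time_user2 | poly_time_user3 | poly_time_user4].

Section Guess.
Variables (A : codeType) (c : A -> ctx) (g : A -> guess) (i : A -> nat).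
Hypotheses (pc : polyt c) (pg : polyt g) (pi : polyt i).

Lemma polyt_team_route : polyt (fun a => team_route (c a) (g a)).
Proof. by rewrite /team_route /agent_graph /adjacent /nagents; poly_time. Qed.

Lemma polyt_team : polyt (fun a => team (c a) (g a)).
Proof. by have := polyt_team_route => ?; rewrite /team; poly_time. Qed.

Lemma polyt_good_guess : polyt (fun a => good_guess (c a) (g a)).
Proof. by have := polyt_team_route => ?; rewrite /good_guess; poly_time. Qed.

Lemma polyt_link : polyt (fun a => link (c a) (g a) (i a)).
Proof. by have := polyt_team => ?; rewrite /link; poly_time. Qed.

Lemma polyt_before : polyt (fun a => before (c a) (g a) (i a)).
Proof. by rewrite /before; poly_time. Qed.

Lemma polyt_between : polyt (fun a => between (c a) (g a) (i a)).
Proof. by rewrite /between; poly_time. Qed.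

Lemma polyt_after : polyt (fun a => after (c a) (g a) (i a)).
Proof. by rewrite /after; poly_time. Qed.

Lemma polyt_solo : polyt (fun a => solo (c a) (i a)).
Proof. by rewrite /solo /block; poly_time. Qed.

Lemma polyt_guesses : polyt (fun a => guesses (c a)).
Proof. by rewrite /guesses /nagents; poly_time. Qed.

End Guess.

Ltac poly_time_user5 := lazymatch goal with
  | |- polyt (fun a => team (@?c a) (@?g a)) => apply: (polyt_team (c := c) (g := g))
  | |- polyt (fun a => good_guess (@?c a) (@?g a)) =>
      apply: (polyt_good_guess (c := c) (g := g))
  | |- polyt (fun a => link (@?c a) (@?g a) (@?i a)) =>
      apply: (polyt_link (c := c) (g := g) (i := i))
  | |- polyt (fun a => before (@?c a) (@?g a) (@?i a)) =>
      apply: (polyt_before (c := c) (g := g) (i := i))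
  | |- polyt (fun a => between (@?c a) (@?g a) (@?i a)) =>
      apply: (polyt_between (c := c) (g := g) (i := i))
  | |- polyt (fun a => after (@?c a) (@?g a) (@?i a)) =>
      apply: (polyt_after (c := c) (g := g) (i := i))
  | |- polyt (fun a => solo (@?c a) (@?i a)) => apply: (polyt_solo (c := c) (i := i))
  | |- polyt (fun a => guesses (@?c a)) => apply: (polyt_guesses (c := c))
  end.
Ltac poly_time_user ::=
  first [poly_time_user1 | poly_time_user2 | poly_time_user3 | poly_time_user4 | poly_time_user5].

Lemma polyt_member_block (A : codeType) (c : A -> ctx) (g : A -> guess) (i : A -> nat) :
  polyt c -> polyt g -> polyt i -> polyt (fun a => member_block (c a) (g a) (i a)).
Proof. by move=> pc pg pi; rewrite /member_block /block; lazy zeta; poly_time. Qed.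

Lemma polyt_build (A : codeType) (c : A -> ctx) (g : A -> guess) :
  polyt c -> polyt g -> polyt (fun a => build (c a) (g a)).
Proof.
move=> pc pg; rewrite /build.
apply: polyt_flatten; apply: polyt_map; first by poly_time.
by apply: (polyt_member_block (c := fun p => c p.1) (g := fun p => g p.1)
  (i := fun p => p.2)); poly_time.
Qed.

Lemma polyt_solve : polyt solve.
Proof.
rewrite /solve; apply: polyt_last_option.
have pc := polyt_mkctx (polyt_id _).
apply: polyt_cat.
  by rewrite /nagents /solo_ok; poly_time.
apply: polyt_map; first by poly_time.
by apply: (polyt_build (c := fun p => mkctx p.1) (g := fun p => p.2)); poly_time.
Qed.

(** * Shortest routes *)

Local Open Scope ring_scope.

(** The expression is stored as function 0, the entry point, and the program it uses moves by
    one. *)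
Lemma polyt_program (A B : codeType) (f : A -> B) : polyt f ->
  exists P d, forall a, exists2 cost,
    runs P (enc a) (enc (f a)) cost & (cost <= vsize (enc a) ^ d)%N.
Proof.
move=> [P [e [cost [pc H]]]].
have [d Hd] := pbounded_add (pbounded_add (pbounded_vs (A := A)) pc) (pbounded_const 1).
exists (shift_calls 1 e :: map (shift_calls 1) P), d => a; have [c E le] := H a.
exists (csize a + c).+1; last by apply: leq_trans (Hd a); rewrite addn1 ltnS leq_add2l.
apply: ECall => //; first exact: EVar.
by have := eval_link [:: shift_calls 1 e] [::] [::] E; rewrite cats0.
Qed.

Lemma foldl_addz (r : route) c : foldl (fun c e => c + e.2) c r = c + rcost r.
Proof.
rewrite /rcost -{1}[c]addr0; elim: r c 0 => [|e r IH] c d //=.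
by rewrite -addrA IH.
Qed.

Lemma rcost_cons e r : rcost (e :: r) = e.2 + rcost r.
Proof. by rewrite {1}/rcost /= foldl_addz add0r. Qed.

Lemma rcost_cat r1 r2 : rcost (r1 ++ r2) = rcost r1 + rcost r2.
Proof. by elim: r1 => [|e r IH]; rewrite ?add0r // cat_cons !rcost_cons IH addrA. Qed.

Fixpoint is_route (G : seq route) (u : nat) (r : route) : bool :=
  if r is e :: r' then (e \in nth [::] G u) && is_route G e.1 r' else true.

Definition rlast (u : nat) (r : route) : nat := last u (map fst r).

Lemma is_route_cat G u r1 r2 :
  is_route G u (r1 ++ r2) = is_route G u r1 && is_route G (rlast u r1) r2.
Proof. by elim: r1 u => //= e r IH u; rewrite IH andbA. Qed.

Lemma rlast_cat u r1 r2 : rlast u (r1 ++ r2) = rlast (rlast u r1) r2.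
Proof. by rewrite /rlast map_cat last_cat. Qed.

Definition wf_graph (G : seq route) :=
  forall u (e : nat * int), e \in nth [::] G u -> (e.1 < size G)%N /\ 0 <= e.2.

Section BellmanFord.
Variable G : seq route.
Hypothesis wfG : wf_graph G.
Local Notation n := (size G).

Lemma rcost_ge0 u r : is_route G u r -> 0 <= rcost r.
Proof.
elim: r u => //= e r IH u /andP[/wfG[_ e0] /IH]; rewrite rcost_cons; lia.
Qed.

Lemma route_mem u r : (u < n)%N -> is_route G u r -> all (fun x => x < n)%N (u :: map fst r).
Proof.
by elim: r u => [|e r IH] u /= -> // /andP[/wfG[en _]]; apply: IH.
Qed.

Lemma route_suffix u r x : is_route G u r -> x \in u :: map fst r ->
  exists r1 r2, [/\ r = r1 ++ r2, rlast u r1 = x & is_route G x r2].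
Proof.
elim: r u => [|e r IH] u /=; first by rewrite inE => _ /eqP->; exists [::], [::].
rewrite inE => /andP[He Hr] /orP[/eqP->|Hx].
  by exists [::], (e :: r); split=> //=; rewrite He.
have [r1 [r2 [-> <- H]]] := IH _ Hr Hx.
by exists (e :: r1), r2.
Qed.

(** Once the tail is simple, a second occurrence of [u] can only be on the tail, and everything
    before it is dropped at no cost as weights are non-negative. The last clause, a strict gain
    unless nothing changes, yields that routes with fewest edges are simple. *)
Lemma shorten_route u r : is_route G u r ->
  exists r', [/\ is_route G u r', rlast u r' = rlast u r, uniq (u :: map fst r'),
                 rcost r' <= rcost r & r' = r \/ (size r' < size r)%N].
Proof.
elim: r u => [|e r IH] u; first by exists [::]; split=> //; left.
rewrite /= => /andP[He /IH[r' [Hr' El Eu Ec Es]]].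
have [_ e0] := wfG He.
have [Hx|Hx] := boolP (u \in e.1 :: map fst r'); last first.
  exists (e :: r'); split=> //=; first by rewrite He.
  - by apply/andP; split.
  - by rewrite !rcost_cons; lia.
  - by case: Es => [->|?]; [left | right].
have [r1 [r2 [E E1 H2]]] := route_suffix Hr' Hx.
exists r2; split=> //.
- by rewrite /rlast /= -/(rlast e.1 r) -El E rlast_cat E1.
- move: Eu; rewrite E map_cat -cat_cons cat_uniq => /and3P[_ /hasPn H U] /=.
  rewrite U andbT; apply/negP => /H; rewrite -E1 /rlast /= mem_last.
  by [].
- rewrite rcost_cons; suff : rcost r2 <= rcost r' by lia.
  rewrite E rcost_cat; have : 0 <= rcost r1; last by lia.
  by move: Hr'; rewrite E is_route_cat => /andP[/rcost_ge0].
- right; rewrite ltnS; apply: (@leq_trans (size r')).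
    by rewrite E size_cat leq_addl.
  by case: Es => [->|/ltnW].
Qed.

Lemma uniq_route_size u r : (u < n)%N -> is_route G u r -> uniq (u :: map fst r) ->
  (size r < n)%N.
Proof.
move=> un Hr U.
have /= := uniq_leq_size (s2 := iota 0 n) U; rewrite size_map size_iota; apply.
by move=> x /(allP (route_mem un Hr)); rewrite mem_iota.
Qed.

Lemma better_le r1 r2 : rcost (better r1 r2) <= rcost r1 /\ rcost (better r1 r2) <= rcost r2.
Proof. by rewrite /better; case: ifP => h; lia. Qed.

Lemma better_or r1 r2 : better r1 r2 = r1 \/ better r1 r2 = r2.
Proof. by rewrite /better; case: ifP; [left | right]. Qed.

Variable M : int.
Hypothesis M0 : 0 <= M.

Let rows v (s : seq route) := foldl (fun row _ => bf_step G row) (bf_init G M v) s.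

Definition valid_entry v x (r : route) :=
  (is_route G x r /\ rlast x r = v) \/ M <= rcost r.

Lemma best_foldl (h : nat * int -> route) z (l : route) :
  let b := foldl (fun best e => better best (h e)) z l in
  [/\ rcost b <= rcost z, forall e, e \in l -> rcost b <= rcost (h e) &
      b = z \/ exists2 e, e \in l & b = h e].
Proof.
elim: l z => [|e l IH] z /=; first by split=> //; left.
have [H1 H2 H3] := IH (better z (h e)).
have [B1 B2] := better_le z (h e).
split.
- exact: le_trans H1 B1.
- move=> e'; rewrite inE => /orP[/eqP->|]; [exact: le_trans H1 B2 | exact: H2].
- case: H3 => [->|[e' He' ->]].
    by case: (better_or z (h e)) => ->; [left | right; exists e; rewrite ?mem_head].
  by right; exists e'; rewrite // inE He' orbT.
Qed.

(** After [size s] rounds an entry competes with all routes of at most [size s] edges. An entry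
    built on a bogus one keeps a cost of at least [M], since only non-negative weights are added. *)
Lemma rows_spec v s : (v < n)%N -> forall x, (x < n)%N ->
  valid_entry v x (nth [::] (rows v s) x) /\
  (forall r, is_route G x r -> rlast x r = v -> (size r <= size s)%N ->
     rcost (nth [::] (rows v s) x) <= rcost r).
Proof.
move=> vn; elim/last_ind: s => [|s y IH] x xn.
  rewrite /rows /bf_init /= (nth_map 0%N) ?size_iota // nth_iota // add0n.
  split.
    by case: eqP => [->|_]; [left | right; rewrite /rcost /= add0r].
  by case=> //= _ <-; rewrite eqxx.
rewrite /rows foldl_rcons -/(rows v s) /bf_step (nth_map 0%N) ?size_iota // nth_iota // add0n.
have [V0 L0] := IH x xn.
have [H1 H2 H3] := best_foldl (fun e => e :: nth [::] (rows v s) e.1)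
  (nth [::] (rows v s) x) (nth [::] G x).
split.
  case: H3 => [->//|[e He ->]]; have [en e0] := wfG He.
  have [[[V1 V2]|V] _] := IH _ en.
    by left; rewrite /= He V1.
  by right; rewrite rcost_cons; lia.
case=> [|e r] /= Hr El Es; first by apply: le_trans H1 (L0 [::] _ _ _).
have /andP[He Hr'] := Hr; have [en e0] := wfG He.
apply: le_trans (H2 _ He) _; rewrite !rcost_cons lerD2l.
have [_] := IH _ en; apply=> //.
by move: Es; rewrite size_rcons ltnS.
Qed.

Lemma sp_le u v r : (u < n)%N -> (v < n)%N -> is_route G u r -> rlast u r = v ->
  rcost (sp G M u v) <= rcost r.
Proof.
move=> un vn Hr El; have [r' [H1 H2 H3 H4 _]] := shorten_route Hr.
have [_ L] := rows_spec G vn un.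
apply: le_trans (L r' _ _ _) H4 => //; first by rewrite H2.
exact/ltnW/(uniq_route_size un).
Qed.

Lemma sp_valid u v : (u < n)%N -> (v < n)%N -> rcost (sp G M u v) < M ->
  is_route G u (sp G M u v) /\ rlast u (sp G M u v) = v.
Proof.
move=> un vn lt; have [[//|V] _] := rows_spec G vn un.
by move: lt; rewrite /sp /bf -/(rows v G); lia.
Qed.

Lemma sp_ge0 u v : (u < n)%N -> (v < n)%N -> 0 <= rcost (sp G M u v).
Proof.
move=> un vn; have [[[V _]|V] _] := rows_spec G vn un; first exact: rcost_ge0 V.
exact: le_trans M0 V.
Qed.

End BellmanFord.

(** * Schedules *)

Arguments mkctx : simpl never.

(** The input as a typed value, on which [solve] is defined; by [enc_raw] its code is the given
    encoding of the instance. *)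
Definition raw (I : instance) : raw_instance :=
  ([seq [seq (nat_of_ord v, (numq (weight u v), denq (weight u v)))
        | v <- enum 'I_(nv I) & edge u v] | u <- enum 'I_(nv I)],
   (nat_of_ord (src I), (nat_of_ord (tgt I),
    [seq (nat_of_ord (home i), (numq (budget i), denq (budget i))) | i <- enum 'I_(na I)]))).

Lemma enc_raw I : enc (raw I) = enc_instance I.
Proof.
rewrite /enc_instance /raw /=; congr (Pair _ (Pair _ (Pair _ _))).
  rewrite -map_comp; congr enc_seq; apply: eq_map => u /=.
  by rewrite -map_comp.
by rewrite -map_comp.
Qed.

(** * Clearing denominators *)

Lemma dvdz_prod (l : seq (nat * (int * int))) c :
  let p := foldl (fun c q => c * q.2.2) c l in
  (c %| p)%Z /\ forall q, q \in l -> (q.2.2 %| p)%Z.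
Proof.
elim: l c => [|q l IH] c /=; first by [].
have [H1 H2] := IH (c * q.2.2); split.
  by apply: dvdz_trans H1; rewrite dvdz_mulr.
move=> q'; rewrite inE => /orP[/eqP->|]; last exact: H2.
by apply: dvdz_trans H1; rewrite dvdz_mull.
Qed.

Lemma prod_gt0 (l : seq (nat * (int * int))) c : 0 < c ->
  {in l, forall q, 0 < q.2.2} -> 0 < foldl (fun c q => c * q.2.2) c l.
Proof.
elim: l c => [|q l IH] c c0 H //=; apply: IH.
  by rewrite mulr_gt0 // H ?mem_head.
by move=> q' Hq'; apply: H; rewrite inE Hq' orbT.
Qed.

Lemma scale_rat (w : rat) (D : int) : (denq w %| D)%Z ->
  ((numq w * D %/ denq w)%Z)%:~R = D%:~R * w.
Proof.
move=> /dvdzP[q ->]; rewrite mulrA mulzK ?denq_eq0 //.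
by rewrite -{3}[w]divq_num_den !intrM; field; rewrite intr_eq0 denq_eq0.
Qed.

Lemma nth_map_enum T n (f : 'I_n -> T) d (u : 'I_n) :
  nth d (map f (enum 'I_n)) u = f u.
Proof. by rewrite (nth_map u) ?size_enum_ord // nth_ord_enum. Qed.

Section Instance.
Variable I : instance.
Local Notation V := 'I_(nv I).
Local Notation c := (mkctx (raw I)).
Local Notation D := (common_den (raw I)).

Lemma den_gt0 : 0 < D.
Proof.
apply: prod_gt0 => // q; rewrite mem_cat => /orP[/flattenP[l /mapP[u _ ->]]|];
  by move=> /mapP[v _ ->]; rewrite /= denq_gt0.
Qed.

Lemma dvd_weight (u v : V) : edge u v -> (denq (weight u v) %| D)%Z.
Proof.
move=> e; have [_] := dvdz_prod (flatten (raw I).1 ++ (raw I).2.2.2) 1.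
move/(_ (nat_of_ord v, (numq (weight u v), denq (weight u v)))); apply.
rewrite mem_cat; apply/orP; left; apply/flattenP.
exists [seq (nat_of_ord v, (numq (weight u v), denq (weight u v)))
        | v <- enum 'I_(nv I) & edge u v]; apply/mapP.
  by exists u; rewrite ?mem_enum.
by exists v; rewrite // mem_filter e mem_enum.
Qed.

Lemma dvd_budget (i : 'I_(na I)) : (denq (budget i) %| D)%Z.
Proof.
have [_] := dvdz_prod (flatten (raw I).1 ++ (raw I).2.2.2) 1.
move/(_ (nat_of_ord (home i), (numq (budget i), denq (budget i)))); apply.
by rewrite mem_cat; apply/orP; right; apply/mapP; exists i; rewrite ?mem_enum.
Qed.

Definition zweight (u v : V) : int := (numq (weight u v) * D %/ denq (weight u v))%Z.

Lemma size_graph : size c.1 = nv I.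
Proof. by rewrite /mkctx /= 2!size_map size_enum_ord. Qed.

Lemma nth_graph (u : V) :
  nth [::] c.1 u = [seq (nat_of_ord v, zweight u v) | v <- enum V & edge u v].
Proof. by rewrite /mkctx /= -map_comp nth_map_enum /= -map_comp. Qed.

Lemma mem_graph u (e : nat * int) : e \in nth [::] c.1 u ->
  exists u' v : V, [/\ u = u', e = (nat_of_ord v, zweight u' v) & edge u' v].
Proof.
have [lt|ge] := ltnP u (nv I); last by rewrite nth_default // size_graph.
rewrite (nth_graph (Ordinal lt)) => /mapP[v]; rewrite mem_filter => /andP[h _] ->.
by exists (Ordinal lt), v.
Qed.

Lemma graph_edge (u v : V) : edge u v ->
  ((nat_of_ord v, zweight u v) : nat * int) \in nth [::] c.1 u.
Proof.
by move=> h; rewrite nth_graph; apply/mapP; exists v; rewrite // mem_filter h mem_enum.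
Qed.

Lemma zweight_ge0 (u v : V) : edge u v -> 0 <= zweight u v.
Proof.
move=> h; rewrite -(ler_int rat) scale_rat ?dvd_weight //.
by rewrite mulr_ge0 ?ler0z ?weight_ge0 // ltW ?den_gt0.
Qed.

Lemma zweight_sym (u v : V) : edge u v -> zweight u v = zweight v u.
Proof. by move=> h; rewrite /zweight weight_sym. Qed.

Lemma wf_ctx : wf_graph c.1.
Proof.
by move=> u e /mem_graph[u' [v [_ -> h]]]; rewrite size_graph ltn_ord zweight_ge0.
Qed.

Lemma nagentsE : nagents c = na I.
Proof. by rewrite /nagents /mkctx /= 2!size_map size_enum_ord. Qed.

Lemma homeE (i : 'I_(na I)) : home_of c i = home i.
Proof. by rewrite /home_of /mkctx /= -map_comp nth_map_enum. Qed.

Lemma foldl_max (l : route) m0 :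
  let m := foldl (fun m e => if m <= e.2 then e.2 else m) m0 l in
  [/\ m0 <= m, {in l, forall e, e.2 <= m} & m = m0 \/ exists2 e, e \in l & m = e.2].
Proof.
elim: l m0 => [|e l IH] m0 /=; first by split=> //; left.
have [H1 H2 H3] := IH (if m0 <= e.2 then e.2 else m0); split.
- by apply: le_trans H1; case: ifP => //; lia.
- move=> e'; rewrite inE => /orP[/eqP->|]; last exact: H2.
  by apply: le_trans H1; case: ifP => //; lia.
- case: H3 => [->|[e' He' ->]]; last by right; exists e'; rewrite // inE He' orbT.
  by case: ifP; [right; exists e; rewrite ?mem_head | left].
Qed.

Lemma budget_le (i : 'I_(na I)) : budget_of c i <= max_budget c.
Proof.
have [_ + _] := foldl_max c.2.2 0; apply.
by apply: mem_nth; rewrite -/(nagents c) nagentsE.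
Qed.

Lemma max_budget_ge0 : 0 <= max_budget c.
Proof. by have [] := foldl_max c.2.2 0. Qed.

Lemma max_budgetP : max_budget c = 0 \/ exists i : 'I_(na I), max_budget c = budget_of c i.
Proof.
rewrite /max_budget; have [_ _ [->|[e /(nthP (0%N, 0))[i]]]] := foldl_max c.2.2 0.
  by left.
rewrite -/(nagents c) nagentsE => lt <- E; right; exists (Ordinal lt).
exact: E.
Qed.

Variable R : realType.
Local Notation toR := (fun z : int => z%:~R : R).
Local Notation wR u v := (ratr (weight u v) : R).

Lemma zweightE (u v : V) : edge u v -> toR (zweight u v) = D%:~R * wR u v.
Proof.
move=> h; rewrite -[LHS](ratr_int R) scale_rat ?dvd_weight //.
by rewrite rmorphM /= ratr_int.
Qed.

Lemma budgetE (i : 'I_(na I)) : toR (budget_of c i) = D%:~R * ratr (budget i).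
Proof.
rewrite /budget_of /mkctx /= -map_comp nth_map_enum /=.
by rewrite -[LHS](ratr_int R) scale_rat ?dvd_budget // rmorphM /= ratr_int.
Qed.

End Instance.

(** * Moves as walks in the graph *)

Section Chains.
Variables (R : realType) (I : instance).
Local Notation V := 'I_(nv I).
Local Notation agent := 'I_(na I).
Local Notation c := (mkctx (raw I)).
Local Notation D := (common_den (raw I)).
Local Notation wR u v := (ratr (weight u v) : R).
Local Notation at_ u := (inl u : loc R I).

Definition fr (q : int * int) : R := q.1%:~R / q.2%:~R.
Definition fraction (q : int * int) := q.2 != 0 /\ 0 <= fr q <= 1.

(** Consecutive moves have to agree as points, so that at a vertex the walk may change edges. The
    length refers to the original weights, whereas [rcost] counts multiples of [1 / D]. *)
Inductive chain : loc R I -> seq move -> loc R I -> R -> Prop :=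
| chain_nil p : chain p [::] p 0
| chain_cons (u v : V) x y ms q L : edge u v -> fraction x -> fraction y ->
    chain (point u v (fr y)) ms q L ->
    chain (point u v (fr x)) ((nat_of_ord u, (nat_of_ord v, (x, y))) :: ms) q
      (`|fr y - fr x| * wR u v + L).

Lemma chain_cat p a q L b r L' : chain p a q L -> chain q b r L' -> chain p (a ++ b) r (L + L').
Proof.
move=> H; elim: H r L' => {p a q L} [p|u v x y ms q L e fx fy _ IH] r L' H2.
  by rewrite add0r.
by rewrite -addrA cat_cons; apply: chain_cons => //; apply: IH.
Qed.

Lemma chain_flip p a q L : chain p a q L -> chain q (flip a) p L.
Proof.
elim=> {p a q L} [p|u v x y ms q L e fx fy _ IH]; first exact: chain_nil.
rewrite /flip rev_cons map_rcons -cats1 addrC; apply: chain_cat IH _.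
by rewrite -[_ * _]addr0 distrC /=; apply: chain_cons => //; apply: chain_nil.
Qed.

Lemma fr0 : fr (0, 1) = 0. Proof. by rewrite /fr mul0r. Qed.
Lemma fr1 : fr (1, 1) = 1. Proof. by rewrite /fr divr1. Qed.
Lemma fraction0 : fraction (0, 1). Proof. by split=> //; rewrite fr0; lra. Qed.
Lemma fraction1 : fraction (1, 1). Proof. by split=> //; rewrite fr1; lra. Qed.

Lemma point0 (u v : V) : point u v 0 = at_ u.
Proof. by rewrite /point eqxx. Qed.

Lemma point1 (u v : V) : point u v 1 = at_ v.
Proof. by rewrite /point oner_eq0 eqxx. Qed.

Lemma D0 : 0 < D%:~R :> R.
Proof. by rewrite ltr0z den_gt0. Qed.

Lemma full_edge (u v : V) ms q L : edge u v -> chain (at_ v) ms q L ->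
  chain (at_ u) ((nat_of_ord u, (nat_of_ord v, ((0, 1), (1, 1)))) :: ms) q (wR u v + L).
Proof.
move=> e H; have := chain_cons e fraction0 fraction1 (ms := ms) (q := q) (L := L).
by rewrite fr0 fr1 point0 point1 subr0 normr1 mul1r; apply.
Qed.

Lemma split_neg k A0 B0 (u v : V) l r : l < 0 -> is_route c.1 u r -> rlast u r = v ->
  exists B1, (foldl (split_step k) ((A0, B0), (nat_of_ord u, l)) r).1 = (A0, B0 ++ B1) /\
    chain (at_ u) B1 (at_ v) ((rcost r)%:~R / D%:~R).
Proof.
move=> + Hr El; elim: r u l B0 Hr El => [|e r IH] u l B0 /=.
  move=> _ /ord_inj-> l0; exists [::]; rewrite cats0 /rcost /= mul0r.
  by split=> //; apply: chain_nil.
move=> /andP[He Hr] El l0.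
have [u' [x [/ord_inj Eu Ee ux]]] := mem_graph He; subst u' e.
rewrite {2}/split_step /= l0 /=.
have [|B1 [-> H]] := IH x (-1) (B0 ++ [:: (nat_of_ord u, (nat_of_ord x, ((0, 1), (1, 1))))]) Hr El.
  by [].
exists ((nat_of_ord u, (nat_of_ord x, ((0, 1), (1, 1)))) :: B1).
rewrite -catA; split=> //.
rewrite rcost_cons intrD mulrDl zweightE //= mulrC mulKf ?gt_eqF ?D0 //.
exact: full_edge.
Qed.

(** The minimum clamps the cut to the end of the route; the last clause is what makes [way] a
    complete walk. *)
Lemma split_pos k A0 B0 (u v : V) l r : 0 < k -> 0 <= l -> is_route c.1 u r -> rlast u r = v ->
  exists A1 B1 z LA LB,
    [/\ (foldl (split_step k) ((A0, B0), (nat_of_ord u, l)) r).1 = (A0 ++ A1, B0 ++ B1),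
        chain (at_ u) A1 z LA, chain z B1 (at_ v) LB,
        LA = (Num.min (k * rcost r) l)%:~R / (k * D)%:~R /\
        LA + LB = (rcost r)%:~R / D%:~R &
        k * rcost r <= l -> B1 = [::]].
Proof.
move=> k0 + Hr El; elim: r u l A0 B0 Hr El => [|e r IH] u l A0 B0 /=.
  move=> _ /ord_inj-> l0; exists [::], [::], (at_ v), 0, 0.
  rewrite !cats0 /rcost /= mulr0 min_l // !mul0r addr0.
  by split=> //; apply: chain_nil.
move=> /andP[He Hr] El l0.
have [u' [x [/ord_inj Eu Ee ux]]] := mem_graph He; subst u' e.
have w0 := zweight_ge0 ux.
have rc0 : 0 <= rcost r by apply: rcost_ge0 Hr; apply: wf_ctx.
rewrite {2}/split_step /= ltNge l0 /= rcost_cons /=.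
have wE := zweightE R ux.
have D1 : D%:~R != 0 :> R by rewrite gt_eqF ?D0.
have k1 : k%:~R != 0 :> R by rewrite intr_eq0 gt_eqF.
case: ifP => [le|/negbT]; last rewrite -ltNge => lt.
  have [|A1 [B1 [z [LA [LB [-> HA HB [ELA ELB] HB1]]]]]] :=
    IH x (l - k * zweight u x) (A0 ++ [:: (nat_of_ord u, (nat_of_ord x, ((0, 1), (1, 1))))])
      B0 Hr El; first by lia.
  exists ((nat_of_ord u, (nat_of_ord x, ((0, 1), (1, 1)))) :: A1), B1, z, (wR u x + LA), LB.
  split=> //.
  - by rewrite -catA.
  - exact: full_edge.
  - split; last first.
      by rewrite -addrA ELB intrD mulrDl wE; congr (_ + _); field.
    rewrite ELA.
    have -> : Num.min (k * (zweight u x + rcost r)) l =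
        k * zweight u x + Num.min (k * rcost r) (l - k * zweight u x) by lia.
    rewrite intrD mulrDl !intrM wE; congr (_ + _); field.
    by rewrite D1 k1.
  - by move=> h; apply: HB1; lia.
(* The cut lies before the end of this edge, so the weight is positive and the fraction [l / (k w)]
   makes sense; edges of weight 0 are never cut. *)
have kw0 : 0 < k * zweight u x by lia.
have [|B1 [-> H]] := @split_neg k
   (A0 ++ [:: (nat_of_ord u, (nat_of_ord x, ((0, 1), (l, k * zweight u x))))])
   (B0 ++ [:: (nat_of_ord u, (nat_of_ord x, ((l, k * zweight u x), (1, 1))))]) x v (-1) r _ Hr El.
  by [].
have kwR : 0 < (k * zweight u x)%:~R :> R by rewrite ltr0z.
have frb : 0 <= fr (l, k * zweight u x) < 1.
  by rewrite /fr /= divr_ge0 ?ler0z ?(ltW kw0) //= ltr_pdivrMr // mul1r ltr_int.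
have fz : fraction (l, k * zweight u x) by split=> /=; [lia | lra].
exists [:: (nat_of_ord u, (nat_of_ord x, ((0, 1), (l, k * zweight u x))))].
exists ((nat_of_ord u, (nat_of_ord x, ((l, k * zweight u x), (1, 1)))) :: B1).
exists (point u x (fr (l, k * zweight u x))).
exists (`|fr (l, k * zweight u x) - fr (0, 1)| * wR u x + 0).
exists (`|fr (1, 1) - fr (l, k * zweight u x)| * wR u x + (rcost r)%:~R / D%:~R).
have wn0 : wR u x != 0.
  by apply/eqP => E; move: kwR; rewrite intrM wE E !mulr0 ltxx.
split=> //.
- by rewrite -catA.
- have := chain_cons ux fraction0 fz (chain_nil _).
  by rewrite fr0 point0.
- by apply: chain_cons => //; [exact: fraction1 | rewrite fr1 point1].
- rewrite fr0 fr1 subr0 ger0_norm; last by lra.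
  rewrite ger0_norm; last by lra.
  split; last first.
    by rewrite intrD mulrDl wE; field.
  rewrite min_r; last by nia.
  by rewrite /fr /= !intrM wE; field; rewrite D1 k1 wn0.
- by nia.
Qed.

End Chains.

(** * Executing encoded schedules *)

Section Execution.
Variables (R : realType) (I : instance).
Local Notation V := 'I_(nv I).
Local Notation agent := 'I_(na I).
Local Notation c := (mkctx (raw I)).
Local Notation D := (common_den (raw I)).
Local Notation wR u v := (ratr (weight u v) : R).
Local Notation at_ u := (inl u : loc R I).
Local Notation DR := (D%:~R : R).

Lemma way_chain (u v : V) : dist c u v <= max_budget c ->
  chain (at_ u) (way c u v) (at_ v) ((dist c u v)%:~R / DR).
Proof.
move=> le.
have M0 : 0 <= max_budget c + 1 by have := max_budget_ge0 I; lia.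
have [un vn] : (u < size c.1)%N /\ (v < size c.1)%N by rewrite size_graph !ltn_ord.
have [|Hr El] := sp_valid (@wf_ctx I) M0 un vn; first by rewrite -/(dist c u v); lia.
have d0 : 0 <= dist c u v := sp_ge0 (@wf_ctx I) M0 un vn.
have [A1 [B1 [z [LA [LB [E HA HB [ELA ELB] HB1]]]]]] :=
  @split_pos R I 1 [::] [::] u v (dist c u v) (route_of c u v) ltr01 d0 Hr El.
rewrite /way /split_route E /=.
have B1E : B1 = [::] by apply: HB1; rewrite mul1r.
rewrite B1E in HB; inversion HB; subst.
by rewrite addr0 in ELB; rewrite /dist -ELB.
Qed.

Definition exec (s : schedule R I) (st : state R I) : option (state R I) :=
  foldl (fun st a => obind (fun st => step st a) st) (Some st) s.

(** Decoding, execution and distances of all agents at once, in a form that composes under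
    concatenation. *)
Definition execs (vals : seq Defs.val) (st st' : state R I) (T : agent -> R) :=
  exists s, [/\ dec_schedule R I (enc_seq vals) = Some s, exec s st = Some st' &
                forall j, travelled j s = T j].

Lemma exec_cat s1 s2 st st' : exec s1 st = Some st' -> exec (s1 ++ s2) st = exec s2 st'.
Proof. by rewrite /exec foldl_cat => ->. Qed.

Lemma dec_cat v1 v2 s1 s2 : dec_schedule R I (enc_seq v1) = Some s1 ->
  dec_schedule R I (enc_seq v2) = Some s2 ->
  dec_schedule R I (enc_seq (v1 ++ v2)) = Some (s1 ++ s2).
Proof.
elim: v1 s1 => [|a v1 IH] s1 /=; first by case=> <-.
case: (dec_action R I a) => [b|] //.
case E: (dec_schedule R I (foldr Pair (Int 0) v1)) => [s|] //= [<-] H2.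
by rewrite [dec_schedule _ _ _](IH s).
Qed.

Lemma execs_cat v1 v2 st st1 st2 T1 T2 : execs v1 st st1 T1 -> execs v2 st1 st2 T2 ->
  execs (v1 ++ v2) st st2 (fun j => T1 j + T2 j).
Proof.
move=> [s1 [D1 E1 H1]] [s2 [D2 E2 H2]]; exists (s1 ++ s2); split.
- exact: dec_cat.
- by rewrite (exec_cat _ E1).
- by move=> j; rewrite /travelled big_cat /= -H1 -H2.
Qed.

Lemma execs_cons a b v st st1 st2 T : dec_action R I a = Some b -> step st b = Some st1 ->
  execs v st1 st2 T -> execs (a :: v) st st2 (fun j => walked j b + T j).
Proof.
move=> Da Eb [s [Ds Es Hs]]; exists (b :: s); split.
- by move: Ds; rewrite /enc_seq /= Da => ->.
- by rewrite /exec /= Eb.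
- by move=> j; rewrite /travelled big_cons -Hs.
Qed.

Lemma walks_execs (i : agent) ms p q L st : chain p ms q L -> pos st i = p ->
  exists st', [/\ execs (walks i ms) st st' (fun j => if j == i then L else 0),
    pos st' i = q, forall j, j != i -> pos st' j = pos st j & msg st' = msg st].
Proof.
move=> H; elim: H st => {p ms q L} [p|u v x y ms q L e fx fy _ IH] st Hp.
  exists st; split=> //; exists [::]; split=> // j.
  by rewrite /travelled big_nil; case: ifP.
pose st1 := State (fun j => if j == i then point u v (fr R y) else pos st j) (msg st).
have [|st' [E1 E2 E3 E4]] := IH st1; first by rewrite /= eqxx.
exists st'; split=> //; last by move=> j ji; rewrite E3 //= (negPf ji).
have [x1 y1] : 0 <= fr R x <= 1 /\ 0 <= fr R y <= 1 by case: fx; case: fy.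
have : execs (walks i ((nat_of_ord u, (nat_of_ord v, (x, y))) :: ms)) st st'
    (fun j => walked j (Walk i u v (fr R x) (fr R y)) + if j == i then L else 0).
  apply: execs_cons E1; last by rewrite /= e x1 y1 Hp eqxx.
  rewrite /= !valK.
  by case: fx => /negPf-> _; case: fy => /negPf-> _.
case=> s [? ? Hs]; exists s; split=> // j.
by rewrite Hs /= eq_sym; case: ifP => // _; rewrite addr0.
Qed.

(** All agents are at home before and after a block, so the blocks of the members can be executed
    one after the other, with only the place of the message passed on. *)
Lemma block_execs (i : agent) pre B mid A post z b b' z' L1 LB L2 LA L3 st :
  chain (at_ (home i)) pre b L1 -> chain z B b LB -> chain b mid b' L2 ->
  chain b' A z' LA -> chain z' (flip A ++ post) (at_ (home i)) (LA + L3) ->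
  pos st =1 (fun j => at_ (home j)) -> msg st = inl z ->
  exists st', [/\ execs (block i pre B mid A post) st st'
      (fun j => if j == i then L1 + L2 + L3 + 2 * (LB + LA) else 0),
    pos st' =1 (fun j => at_ (home j)) & msg st' = inl z'].
Proof.
move=> H1 HB H2 HA H3 Hpos Hmsg.
have [st1 [E1 p1 o1 m1]] := walks_execs (chain_cat H1 (chain_flip HB)) (Hpos i).
pose st2 := State (pos st1) (inr i : loc R I + agent).
have [|st3 [E3 p3 o3 m3]] := walks_execs (st := st2) (chain_cat HB (chain_cat H2 HA)) (i := i).
  by rewrite /= p1.
pose st4 := State (pos st3) (inl z' : loc R I + agent).
have [|st5 [E5 p5 o5 m5]] := walks_execs (st := st4) H3 (i := i); first by rewrite /= p3.
exists st5; split; last by rewrite m5.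
  have [s [? ? Hs]] : execs (block i pre B mid A post) st st5 (fun j =>
      (if j == i then L1 + LB else 0) + (walked j (PickUp R i) +
      ((if j == i then LB + (L2 + LA) else 0) + (walked j (Drop R i) +
      (if j == i then LA + L3 else 0))))).
    apply: execs_cat E1 _; apply: execs_cons.
    - by rewrite /= valK.
    - by rewrite /= m1 Hmsg p1 eqxx.
    apply: execs_cat E3 _; apply: execs_cons E5.
    - by rewrite /= valK.
    - by rewrite /= m3 /= eqxx p3.
  exists s; split=> // j; rewrite Hs /=; case: ifP => _; lra.
move=> j; have [->//|ji] := eqVneq j i.
by rewrite o5 //= o3 //= o1.
Qed.

Lemma execs_feasible (B : agent -> R) vals st T :
  execs vals (init R I) st T -> pos st =1 (fun j => at_ (home j)) ->
  msg st = inl (at_ (tgt I)) -> (forall j, T j <= B j) ->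
  exists s, dec_schedule R I (enc_seq vals) = Some s /\ feasible B s.
Proof.
move=> [s [Ds Es Hs]] Hp Hm HT; exists s; split=> //; exists st; split=> //.
by move=> j; rewrite Hs.
Qed.

End Execution.

(** * The graph of agents *)

Lemma nth_agent_graph c g i : (i < nagents c)%N ->
  nth [::] (agent_graph c g) i = [seq (j, 1) | j <- iota 0 (nagents c) & adjacent c g i j].
Proof. by move=> lt; rewrite (nth_map 0%N) ?size_iota // nth_iota. Qed.

Lemma size_agent_graph c g : size (agent_graph c g) = nagents c.
Proof. by rewrite size_map size_iota. Qed.

Lemma mem_agent_graph c g i (e : nat * int) : e \in nth [::] (agent_graph c g) i ->
  [/\ (i < nagents c)%N, (e.1 < nagents c)%N, adjacent c g i e.1 & e.2 = 1].
Proof.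
have [lt|ge] := ltnP i (nagents c); last by rewrite nth_default // size_agent_graph.
rewrite nth_agent_graph // => /mapP[j]; rewrite mem_filter mem_iota => /andP[? ?] -> /=.
by split.
Qed.

Lemma wf_agent_graph c g : wf_graph (agent_graph c g).
Proof. by move=> u e /mem_agent_graph[_ ? _ ->]; rewrite size_agent_graph. Qed.

Lemma rcost_agents c g i r : is_route (agent_graph c g) i r -> rcost r = size r.
Proof.
elim: r i => [|e r IH] i //= /andP[/mem_agent_graph[_ _ _ E] /IH].
by rewrite rcost_cons E => ->; lia.
Qed.

Lemma route_adjacent c g a r i : is_route (agent_graph c g) a r -> (i < size r)%N ->
  adjacent c g (nth 0%N (a :: map fst r) i) (nth 0%N (a :: map fst r) i.+1).
Proof.
elim: r a i => // e r IH a [|i] /= /andP[/mem_agent_graph[_ _ Ha _] Hr] //.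
by rewrite ltnS; apply: IH.
Qed.

Section Team.
Variables (c : ctx) (g : guess).
Hypotheses (a_lt : (g.1 < nagents c)%N) (b_lt : (g.2.2.1 < nagents c)%N).
Local Notation k := (nagents c).

(** With unit weights the cheapest route has the fewest edges; if it repeated an agent, shortening
    it would give a strictly cheaper one. *)
Lemma team_routeP : rcost (team_route c g) < k ->
  [/\ is_route (agent_graph c g) g.1 (team_route c g),
      rlast g.1 (team_route c g) = g.2.2.1 & uniq (team c g)].
Proof.
move=> lt; have wf := @wf_agent_graph c g.
have [Ha Hb] : (g.1 < size (agent_graph c g))%N /\ (g.2.2.1 < size (agent_graph c g))%N.
  by rewrite size_agent_graph.
have k0 : 0 <= Posz k by [].
have [Hr El] := sp_valid wf k0 Ha Hb lt; split=> //.
have [r' [H1 H2 H3 H4 [E|lts]]] := shorten_route wf Hr; first by rewrite /team /team_route -E.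
have := sp_le wf k0 Ha Hb H1 (etrans H2 El).
by rewrite (rcost_agents H1) (rcost_agents Hr); lia.
Qed.

Lemma teamP : good_guess c g ->
  [/\ uniq (team c g), (forall j, j \in team c g -> (j < k)%N),
      (1 < size (team c g) <= k)%N,
      nth 0%N (team c g) 0 = g.1 /\ nth 0%N (team c g) (size (team c g)).-1 = g.2.2.1 &
      forall i, (i.+1 < size (team c g))%N ->
        adjacent c g (nth 0%N (team c g) i) (nth 0%N (team c g) i.+1)].
Proof.
move=> /and4P[/eqP ab _ _ lt]; have [Hr El U] := team_routeP lt.
have lts : forall j, j \in team c g -> (j < k)%N.
  move=> j; have h := route_mem (@wf_agent_graph c g) _ Hr.
  by rewrite size_agent_graph in h; apply: (allP (h a_lt)).
split=> //.
- apply/andP; split.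
    by move: El; rewrite /team; case: (team_route c g) => //= E; case: ab.
  have := uniq_leq_size (s2 := iota 0 k) U; rewrite size_iota; apply.
  by move=> x /lts; rewrite mem_iota.
- by split=> //; rewrite nth_last.
- by move=> i; rewrite /= ltnS size_map; apply: route_adjacent.
Qed.

End Team.

(** * Schedules from solo agents and good guesses *)

Section Soundness.
Variables (R : realType) (I : instance).
Local Notation V := 'I_(nv I).
Local Notation agent := 'I_(na I).
Local Notation c := (mkctx (raw I)).
Local Notation D := (common_den (raw I)).
Local Notation at_ u := (inl u : loc R I).
Local Notation DR := (D%:~R : R).
Local Notation k := (na I).
Local Notation beta := (max_budget c).

Lemma dist_ge0 (u v : V) : 0 <= dist c u v.
Proof.
apply: (sp_ge0 (@wf_ctx I)); rewrite ?size_graph ?ltn_ord //.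
by have := max_budget_ge0 I; lia.
Qed.

Lemma route_ofP (u v : V) : dist c u v <= beta ->
  is_route c.1 u (route_of c u v) /\ rlast u (route_of c u v) = v.
Proof.
move=> le; apply: (sp_valid (@wf_ctx I)); rewrite ?size_graph ?ltn_ord //.
  by have := max_budget_ge0 I; lia.
by rewrite -/(route_of c u v) -/(dist c u v); lia.
Qed.

Lemma tour_ge0 (q x : V) (j : agent) : 0 <= tour c q j x.
Proof.
by rewrite /tour homeE; have := dist_ge0 (home j) q; have := dist_ge0 q x;
   have := dist_ge0 (home j) x; lia.
Qed.

Lemma tour_parts (q x : V) (j : agent) : tour c q j x <= beta ->
  [/\ dist c (home j) q <= beta, dist c q x <= beta & dist c (home j) x <= beta].
Proof.
by rewrite /tour homeE; have := dist_ge0 (home j) q; have := dist_ge0 q x;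
   have := dist_ge0 (home j) x; split; lia.
Qed.

Lemma solo_feasible (j : agent) (B : agent -> R) : solo_ok c j ->
  (forall i, ratr (budget i) <= B i) ->
  exists s, dec_schedule R I (enc_seq (solo c j)) = Some s /\ feasible B s.
Proof.
rewrite /solo_ok => ok HB; have le := le_trans ok (budget_le j).
have [d1 d2 d3] := tour_parts le.
have H1 := way_chain R d1; have H2 := way_chain R d2; have H3 := way_chain R d3.
have H3' := chain_flip H3.
rewrite -[flip _]cat0s -[X in chain _ _ _ X]add0r in H3'.
have [st [E p m]] := block_execs (st := init R I) H1 (chain_nil _) H2 (chain_nil _) H3'
  (fun=> erefl) erefl.
rewrite /solo homeE; apply: execs_feasible E p m _ => i.
case: eqP => [->|_]; last first.
  by apply: le_trans (HB i); rewrite ler0q ltW // budget_gt0.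
apply: le_trans (HB j); rewrite addr0 mulr0 addr0 -!mulrDl ler_pdivrMr ?D0 // mulrC.
by rewrite -budgetE -!intrD ler_int; move: ok; rewrite /tour homeE.
Qed.

Variable g : guess.
Hypotheses (a_lt : (g.1 < k)%N) (b_lt : (g.2.2.1 < k)%N)
  (x_lt : (g.2.1 < nv I)%N) (y_lt : (g.2.2.2 < nv I)%N).
Hypothesis ok : good_guess c g.

Local Notation P := (team c g).
Local Notation m := (size P).
Local Notation mem i := (nth 0%N P i).
Local Notation res j := (residual c g j).

Lemma team_spec :
  [/\ uniq P, (forall j, j \in P -> (j < k)%N), (1 < m <= k)%N,
      mem 0%N = g.1 /\ mem m.-1 = g.2.2.1 &
      forall i, (i.+1 < m)%N -> adjacent c g (mem i) (mem i.+1)].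
Proof. by have := @teamP c g; rewrite nagentsE => /(_ a_lt b_lt ok). Qed.

Lemma base_vertex j : (j < k)%N -> exists v : V, nat_of_ord v = base c g j.
Proof.
move=> lt; rewrite /base; case: ifP => _; first by exists (Ordinal x_lt).
case: ifP => _; first by exists (Ordinal y_lt).
by exists (home (Ordinal lt)); rewrite -homeE.
Qed.

Lemma residual_ge0 (j : agent) : 0 <= res j.
Proof.
have /and4P[ab ra rb _] := ok.
have [->//|nja] := eqVneq (nat_of_ord j) g.1.
have [->//|njb] := eqVneq (nat_of_ord j) g.2.2.1.
rewrite /residual (negPf nja) (negPf njb) -(ler_int R) budgetE.
by rewrite mulr_ge0 ?ler0z ?ler0q // ltW ?den_gt0 ?budget_gt0.
Qed.

Lemma residual_le_budget (j : agent) : res j <= budget_of c j.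
Proof.
rewrite /residual; case: ifP => _.
  by have := tour_ge0 (src I) (Ordinal x_lt) j; rewrite /=; lia.
case: ifP => _ //.
by have := tour_ge0 (tgt I) (Ordinal y_lt) j; rewrite /=; lia.
Qed.

Lemma residual_le (j : agent) : res j <= beta.
Proof. exact: le_trans (residual_le_budget j) (budget_le j). Qed.

(* Where the [i]-th member of the team, going from home, starts to approach the
   place of its pick-up, and where it starts to approach the place of its drop. *)
Definition entry i : nat := if i == 0%N then nat_of_ord (src I) else base c g (mem i).
Definition exit i : nat := if i == m.-1 then nat_of_ord (tgt I) else base c g (mem i).

(** The tour subtracted from the budget of an end agent is exactly its walk apart from the links, so
    the residual budget is what is left for the links. *)
Lemma member_tour i (j : agent) : (i < m)%N -> mem i = j -> exists (v w : V) L1 L2 L3,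
  [/\ nat_of_ord v = entry i /\ nat_of_ord w = exit i,
      chain (at_ (home j)) (before c g j) (at_ v) L1,
      chain (at_ v) (between c g j) (at_ w) L2,
      chain (at_ w) (after c g j) (at_ (home j)) L3 &
      L1 + L2 + L3 = (budget_of c j - res j)%:~R / DR].
Proof.
move=> im Ej; have [U _ /andP[m1 _] [E0 Em] _] := team_spec.
have /and4P[/negPf ab ra rb _] := ok.
have m0 : (0 < m)%N by apply: ltnW.
have i0 : (i == 0%N) = (nat_of_ord j == g.1) by rewrite -Ej -E0 nth_uniq.
have i1 : (i == m.-1) = (nat_of_ord j == g.2.2.1).
  by rewrite -Ej -Em nth_uniq // prednK.
rewrite /entry /exit i0 i1 Ej /before /between /after /residual /base.
have [Ea|na] := eqVneq (nat_of_ord j) g.1.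
  rewrite Ea ab -Ea.
  have ra' : tour c (src I) j (Ordinal x_lt) <= budget_of c j.
    by move: ra; rewrite /residual eqxx -Ea /=; lia.
  have [d1 d2 d3] := tour_parts (le_trans ra' (budget_le j)).
  exists (src I), (Ordinal x_lt).
  do 3!eexists; split=> //.
  - rewrite homeE; exact: way_chain d1.
  - exact: way_chain d2.
  - rewrite homeE; exact: chain_flip (way_chain R d3).
  - by rewrite subKr /tour homeE -!mulrDl !intrD.
have [Eb|nb] := eqVneq (nat_of_ord j) g.2.2.1.
  have rb' : tour c (tgt I) j (Ordinal y_lt) <= budget_of c j.
    by move: rb; rewrite /residual eq_sym ab eqxx -Eb /=; lia.
  have [d1 d2 d3] := tour_parts (le_trans rb' (budget_le j)).
  exists (Ordinal y_lt), (tgt I).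
  do 3!eexists; split=> //.
  - rewrite homeE; exact: way_chain d3.
  - exact: chain_flip (way_chain R d2).
  - rewrite homeE; exact: chain_flip (way_chain R d1).
  - by rewrite subKr /tour homeE -!mulrDl !intrD; congr (_ / _); ring.
exists (home j), (home j), 0, 0, 0; rewrite homeE subrr mul0r !addr0.
by split=> //; exact: chain_nil.
Qed.

Definition pos_part (z : int) : int := Num.max 0 z.

(** Bounds that hold for every cut length: [pos_part] accounts for a cut clamped to the start or to
    the end of the route. *)
Lemma split_bounds q (u v : V) l r : 0 < q -> is_route c.1 u r -> rlast u r = v ->
  exists z LA LB,
    [/\ chain (at_ u) (split_route q u r l).1 z LA,
        chain z (split_route q u r l).2 (at_ v) LB,
        LA * (q * D)%:~R <= (pos_part l)%:~R &
        LB * (q * D)%:~R <= (pos_part (q * rcost r - l))%:~R].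
Proof.
move=> q0 Hr El; rewrite /split_route /pos_part.
have D1 : DR != 0 by rewrite gt_eqF ?D0.
have q1 : q%:~R != 0 :> R by rewrite intr_eq0 gt_eqF.
have rc0 := rcost_ge0 (@wf_ctx I) Hr.
have [l0|l0] := lerP 0 l.
  have [A1 [B1 [z [LA [LB [-> HA HB [ELA ELB] _]]]]]] :=
    @split_pos R I q [::] [::] u v l r q0 l0 Hr El.
  exists z, LA, LB; split=> //=.
    by rewrite ELA divfK ?intr_eq0 ?mulf_neq0 ?gt_eqF ?den_gt0 // ler_int; lia.
  have -> : LB = (rcost r)%:~R / DR - LA by rewrite -ELB; ring.
  rewrite ELA.
  have -> : ((rcost r)%:~R / DR - (Num.min (q * rcost r) l)%:~R / (q * D)%:~R) * (q * D)%:~R =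
      (q * rcost r - Num.min (q * rcost r) l)%:~R.
    by rewrite intrB !intrM; field; rewrite q1 D1.
  by rewrite ler_int; lia.
have [B1 [-> H]] := @split_neg R I q [::] [::] u v l r l0 Hr El.
exists (at_ u), 0, ((rcost r)%:~R / DR); split=> //=; first exact: chain_nil.
  by rewrite mul0r ler0z; lia.
have -> : (rcost r)%:~R / DR * (q * D)%:~R = (q * rcost r)%:~R by rewrite !intrM; field.
by rewrite ler_int; lia.
Qed.

(** In units of [1 / (2 k D)], the distances res / 2 minus the previous shift and res / 2 plus the
    own shift. The [i]-th member has rank [i.+1], so the previous shift has index [i]. *)
Definition in_bound i : int :=
  pos_part (Posz k * res (mem i) - (Posz k - 2 * Posz i) * beta).
Definition out_bound i : int :=
  pos_part (Posz k * res (mem i) + (Posz k - 2 * Posz i.+1) * beta).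

Lemma mem_agent i : (i < m)%N -> exists j : agent, mem i = j.
Proof.
move=> im; have [_ lts _ _ _] := team_spec.
by have := lts _ (mem_nth 0%N im); move=> lt; exists (Ordinal lt).
Qed.

(** Adjacency bounds twice the route by the sum of both residual budgets; subtracting the part
    before the cut leaves half of the second residual minus the shift. *)
Lemma link_bounds i : (i.+1 < m)%N -> exists (u v : V) z LA LB,
  [/\ nat_of_ord u = base c g (mem i) /\ nat_of_ord v = base c g (mem i.+1),
      chain (at_ u) (link c g i).1 z LA, chain z (link c g i).2 (at_ v) LB,
      LA * (k%:Z * 2 * D)%:~R <= (out_bound i)%:~R &
      LB * (k%:Z * 2 * D)%:~R <= (in_bound i.+1)%:~R].
Proof.
move=> im.
have [j1 E1] := mem_agent (ltnW im); have [j2 E2] := mem_agent im.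
have [u Eu] := base_vertex (ltn_ord j1); have [v Ev] := base_vertex (ltn_ord j2).
have adj : adjacent c g j1 j2.
  by have [_ _ _ _ /(_ i im)] := team_spec; rewrite E1 E2.
have r1 := residual_le j1; have r2 := residual_le j2.
rewrite /adjacent -Eu -Ev in adj.
have [|Hr El] := @route_ofP u v; first by lia.
have k0 : 0 < (k%:Z * 2) by have := ltn_ord j1; lia.
have [z [LA [LB [HA HB LA1 LB1]]]] := split_bounds
  (Posz k * res j1 + (Posz k - 2 * Posz i.+1) * beta) k0 Hr El.
exists u, v, z, LA, LB; rewrite /link /out_bound /in_bound E1 E2 nagentsE -Eu -Ev.
split=> //; apply: le_trans LB1 _; rewrite ler_int /pos_part.
rewrite -/(dist c u v).
have : k%:Z * (dist c u v * 2) <= k%:Z * (res j1 + res j2) by rewrite ler_pM2l; lia.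
by lia.
Qed.

(** If neither bound is clamped, the sum is 2 k res - 2 beta and res <= beta suffices. If only the
    outgoing one is positive, its shift k - 2 (i + 1) is at most k - 2; if only the incoming one is,
    2 i - k <= k - 2 holds because i < m <= k. *)
Lemma bounds_sum i : (i < m)%N ->
  in_bound i + out_bound i <= Posz k * res (mem i) + (Posz k - 2) * beta.
Proof.
move=> im; have [j Ej] := mem_agent im.
have r0 := residual_ge0 j; have rb := residual_le j; rewrite -Ej in r0 rb.
have mk : (m <= k)%N.
  by have [_ _ /andP[_ ?] _ _] := team_spec.
have m1 : (1 < m)%N.
  by have [_ _ /andP[? _] _ _] := team_spec.
rewrite /in_bound /out_bound /pos_part; move: (res _) (beta) r0 rb => r b r0 rb.
have b0 : 0 <= b by lia.
have [K [Ek K2]] : exists K : int, Posz k = K /\ 2 <= K by exists (Posz k); lia.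
have [i' [Ei i0]] : exists i' : int, Posz i = i' /\ 0 <= i' <= K - 1 by exists (Posz i); lia.
have -> : Posz i.+1 = i' + 1 by lia.
rewrite Ek Ei.
have h1 : K * r <= K * b by nia.
have h2 : 0 <= (K - 1 - i') * b by nia.
have h3 : 0 <= i' * b by nia.
have h4 : 0 <= (K - 2) * b by nia.
have h5 : 0 <= K * r by nia.
by lia.
Qed.

Lemma mem_agent_inj i i' : (i < m)%N -> (i' < m)%N -> mem i = mem i' -> i = i'.
Proof.
move=> im im' E; have [U _ _ _ _] := team_spec.
by apply/eqP; rewrite -(nth_uniq 0%N im im' U) E.
Qed.

Lemma build_feasible (B : agent -> R) :
  (forall j : agent, (Posz k * budget_of c j + (Posz k - 2) * beta)%:~R <= B j * (k%:Z * D)%:~R) ->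
  exists s, dec_schedule R I (enc_seq (build c g)) = Some s /\ feasible B s.
Proof.
move=> HB.
have kD0 : 0 < (k%:Z * D)%:~R :> R.
  by rewrite ltr0z mulr_gt0 ?den_gt0 //; move: a_lt; lia.
have m1 : (1 < m)%N.
  by have [_ _ /andP[? _] _ _] := team_spec.
have B0 (j : agent) : 0 <= B j.
  rewrite -(pmulr_lge0 _ kD0); apply: le_trans (HB j); rewrite ler0z.
  have b0 : 0 <= budget_of c j := le_trans (residual_ge0 j) (residual_le_budget j).
  have := max_budget_ge0 I; move: (budget_of c j) beta b0 => b b' b0 b0'.
  have k2 : (1 < k)%N.
    by have [_ _ /andP[? ?] _ _] := team_spec; apply: leq_trans m1 _.
  by rewrite addr_ge0 // mulr_ge0 //; lia.
pose B_ i := if (i <= 0)%N then [::] else (link c g i.-1).2.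
(* After [i] blocks everyone is at home and the message lies at [z], from where the remaining part
   of the last link leads to the entry of the next member. Agents that have not acted have walked
   nothing. *)
have inv i : (i <= m)%N -> exists st z T,
  [/\ execs (flatten [seq member_block c g i | i <- iota 0 i]) (init R I) st T,
      pos st =1 (fun j => at_ (home j)), msg st = inl z,
      (forall j, T j <= B j) /\
      (forall j : agent, (forall i', (i' < i)%N -> mem i' <> j) -> T j = 0) &
      if (i < m)%N then exists (v : V) LB, [/\ nat_of_ord v = entry i,
          chain z (B_ i) (at_ v) LB & LB * (k%:Z * 2 * D)%:~R <= (in_bound i)%:~R]
      else z = at_ (tgt I)].
  elim: i => [|i IH] im.
    exists (init R I), (at_ (src I)), (fun=> 0); split=> //.
    - by exists [::]; split=> // j; rewrite /travelled big_nil.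
    - rewrite (ltnW m1); exists (src I), 0; split=> //; first exact: chain_nil.
      by rewrite mul0r ler0z /in_bound /pos_part; lia.
  have [st [z [T [E p Em [TB T0] +]]]] := IH (ltnW im).
  rewrite im => -[v [LB [Ev HzB LBb]]].
  have [j Ej] := mem_agent im.
  have [v' [w [L1 [L2 [L3 [[Ev' Ew] H1 H2 H3 EL]]]]]] := member_tour im Ej.
  have /ord_inj Evv : nat_of_ord v = v' by rewrite Ev Ev'.
  subst v'.
  have [z' [A [LA [EA HA LAb Hz']]]] : exists z' A LA,
      [/\ A = (if (i.+2 <= m)%N then (link c g i).1 else [::]),
          chain (at_ w) A z' LA, LA * (k%:Z * 2 * D)%:~R <= (out_bound i)%:~R &
          if (i.+1 < m)%N then exists (v : V) LB, [/\ nat_of_ord v = entry i.+1,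
          chain z' (B_ i.+1) (at_ v) LB & LB * (k%:Z * 2 * D)%:~R <= (in_bound i.+1)%:~R]
          else z' = at_ (tgt I)].
    case: ifP => [im1|im1]; last first.
      (* The last member has no further link: it drops the message at its exit, the target. *)
      exists (at_ w), [::], 0; rewrite mul0r ler0z /out_bound /pos_part.
      split=> //; [exact: chain_nil|by lia|].
      suff -> : w = tgt I by [].
      apply: ord_inj; rewrite Ew /exit; suff -> : i == m.-1 by [].
      by move: im im1; lia.
    have [u [v1 [z' [LA [LB' [[Eu Ev1] HA HB' LA' LB'']]]]]] := link_bounds im1.
    exists z', (link c g i).1, LA; split=> //.
      suff -> : w = u by [].
      apply: ord_inj; rewrite Ew Eu /exit; case: eqP => // E1.
      by move: im1; rewrite E1; lia.
    by exists v1, LB'; split=> //; rewrite Ev1 /entry.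
  have [st' [E' p' m']] := block_execs H1 HzB H2 HA (chain_cat (chain_flip HA) H3) p Em.
  exists st', z'; eexists; split=> //.
  - rewrite -addn1 iotaD map_cat flatten_cat /= cats0 add0n.
    have -> : member_block c g i =
        block j (before c g j) (B_ i) (between c g j) A (after c g j).
      by rewrite /member_block Ej EA.
    exact: execs_cat E E'.
  - split=> j'; last first.
      move=> Hj'; rewrite T0; last by move=> i' ii'; apply: Hj'; apply: ltnW.
      by case: eqP => [Ejj|_]; [case: (Hj' i (ltnSn _)); rewrite Ejj | rewrite addr0].
    case: eqP => [->|_]; last by rewrite addr0.
    (* Members are distinct, so this block accounts for the whole walk of agent [j]. *)
    rewrite T0 ?add0r; last first.
      move=> i' ii' E1; have := mem_agent_inj (ltn_trans ii' im) im.
      by rewrite E1 Ej => /(_ erefl); move: ii'; lia.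
    rewrite -(ler_pM2r kD0); apply: le_trans (HB j).
    have := bounds_sum im; rewrite -(ler_int R) intrD => bs.
    rewrite EL.
    have D1 : DR != 0 by rewrite gt_eqF ?D0.
    have -> : ((budget_of c j - res j)%:~R / DR + 2 * (LB + LA)) * (k%:Z * D)%:~R =
        (k%:Z * (budget_of c j - res j))%:~R +
        (LB * (k%:Z * 2 * D)%:~R + LA * (k%:Z * 2 * D)%:~R).
      by rewrite !intrM intrB; field.
    apply: le_trans (lerD (lexx _) (lerD LBb LAb)) _.
    apply: le_trans (lerD (lexx _) bs) _.
    by rewrite -intrD ler_int Ej; lia.
have [st [z [T [E p Em [TB _] +]]]] := inv m (leqnn _).
rewrite ltnn => Ez; rewrite Ez in Em.
exact: execs_feasible E p Em TB.
Qed.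

End Soundness.

(** * Necessity of the tests *)

Section Reach.
Variables (R : realType) (I : instance).
Local Notation V := 'I_(nv I).
Local Notation agent := 'I_(na I).
Local Notation c := (mkctx (raw I)).
Local Notation D := (common_den (raw I)).
Local Notation at_ u := (inl u : loc R I).
Local Notation DR := (D%:~R : R).
Local Notation beta := (max_budget c).
Local Notation W u v := ((zweight u v)%:~R : R).

Implicit Types u v w : V.

(* Lengths are in units of [1 / D]. *)
Definition within (u v : V) (x : R) : Prop :=
  exists r, [/\ is_route c.1 u r, rlast u r = v & (rcost r)%:~R <= x].

Lemma within0 u x : 0 <= x -> within u u x.
Proof. by exists [::]; split=> //; rewrite /rcost. Qed.

Lemma within_ge0 u v x : within u v x -> 0 <= x.
Proof.
case=> r [Hr _ h]; apply: le_trans h; rewrite ler0z.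
exact: rcost_ge0 (@wf_ctx I) _ _ Hr.
Qed.

Lemma within_le u v x y : x <= y -> within u v x -> within u v y.
Proof. by move=> xy [r [? ? h]]; exists r; split=> //; apply: le_trans h xy. Qed.

Lemma within_trans u v w x y : within u v x -> within v w y -> within u w (x + y).
Proof.
move=> [r [H1 E1 h1]] [r' [H2 E2 h2]]; exists (r ++ r').
by rewrite is_route_cat rlast_cat E1 H1 H2 E2 rcost_cat intrD lerD.
Qed.

Lemma within_edge u v : edge u v -> within u v (W u v).
Proof.
move=> e; exists [:: (nat_of_ord v, zweight u v)].
by rewrite /= graph_edge // rcost_cons /rcost /= addr0.
Qed.

Lemma within_sym u v x : within u v x -> within v u x.
Proof.
case=> r [Hr El h]; apply: within_le h _; elim: r u Hr El => [|e r IH] u /=.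
  by move=> _ /ord_inj ->; apply: within0.
move=> /andP[/mem_graph[u' [w [/ord_inj Eu Ee uw]]] Hr] El; subst u' e.
rewrite rcost_cons addrC intrD; apply: within_trans (IH w Hr El) _.
by rewrite /= zweight_sym //; apply: within_edge; rewrite edge_sym.
Qed.

Lemma within_dist u v x : within u v x -> (dist c u v)%:~R <= x.
Proof.
case=> r [Hr El h]; apply: le_trans h; rewrite ler_int.
apply: (sp_le (@wf_ctx I)) => //; rewrite ?size_graph ?ltn_ord //.
by have := max_budget_ge0 I; lia.
Qed.

Lemma dist_within u v : dist c u v <= beta -> within u v (dist c u v)%:~R.
Proof. by move=> /route_ofP[? ?]; exists (route_of c u v). Qed.

Lemma dist_sym u v : dist c u v <= beta -> dist c v u <= dist c u v.
Proof. by move=> /dist_within/within_sym/within_dist; rewrite ler_int. Qed.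

Lemma dist_triangle u v w : dist c u v <= beta -> dist c v w <= beta ->
  dist c u w <= dist c u v + dist c v w.
Proof.
move=> /dist_within h1 /dist_within h2.
by have := within_dist (within_trans h1 h2); rewrite -intrD ler_int.
Qed.

(** A point inside an edge is reached through one of the endpoints, the rest of the length being
    spent on the edge. *)
Definition reach (q : V) (z : loc R I) (x : R) : Prop :=
  match z with
  | inl v => within q v x
  | inr (u, v, t) => [/\ edge u v, 0 <= t <= 1 &
      within q u (x - t * W u v) \/ within q v (x - (1 - t) * W u v)]
  end.

Lemma W_ge0 u v : edge u v -> 0 <= W u v.
Proof. by move=> e; rewrite ler0z zweight_ge0. Qed.

(** Removes the normalization in [point]. At an endpoint, the alternative through the other end
    contains the full edge, and hence a route to this endpoint. *)
Lemma reach_point q (u v : V) t x : edge u v -> 0 <= t <= 1 ->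
  reach q (point u v t) x <->
  within q u (x - t * W u v) \/ within q v (x - (1 - t) * W u v).
Proof.
move=> e t01; have w0 := W_ge0 e; have Euv := within_edge e.
rewrite /point; have [->|t0] := eqVneq t 0.
  rewrite mul0r !subr0 mul1r /=; split=> [h|[//|h]]; first by left.
  by have := within_trans h (within_sym Euv); rewrite subrK.
have [->|t1] := eqVneq t 1.
  rewrite mul1r subrr mul0r subr0 /=; split=> [h|[h|//]]; first by right.
  by have := within_trans h Euv; rewrite subrK.
case: ifP => uv /=; first by split=> [[]|].
have evu : edge v u by rewrite edge_sym.
have Ew : W v u = W u v by rewrite zweight_sym.
rewrite Ew subKr; split=> [[_ _ []]|h]; [by right|by left|].
split=> //; first by lra.
by case: h; [right | left].
Qed.

(** A move changes the distance to either endpoint by at most its length, so the same alternative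
    remains valid. *)
Lemma reach_move q (u v : V) t t' x : edge u v -> 0 <= t <= 1 -> 0 <= t' <= 1 ->
  reach q (point u v t) x -> reach q (point u v t') (x + `|t' - t| * W u v).
Proof.
move=> e t01 t01'; have w0 := W_ge0 e.
have h1 : (t' - t) * W u v <= `|t' - t| * W u v by rewrite ler_wpM2r // ler_norm.
have h2 : (t - t') * W u v <= `|t' - t| * W u v by rewrite distrC ler_wpM2r // ler_norm.
move=> /reach_point => /(_ e t01) h; apply/reach_point => //.
move: h1 h2; rewrite !mulrBl => h1 h2.
by case: h => h; [left | right]; apply: within_le h; rewrite ?mulrBl ?mul1r; lra.
Qed.

Lemma step_reach q (st st' : state R I) a i x : step st a = Some st' ->
  (reach q (pos st i) x -> reach q (pos st' i) (x + DR * walked i a)) /\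
  (reach q (pos st' i) x -> reach q (pos st i) (x + DR * walked i a)).
Proof.
case: a => [j u v t t'|j|j] /=; last 2 first.
- by case: ifP => // _ [<-]; rewrite mulr0 addr0.
- by case: ifP => // _ [<-]; rewrite mulr0 addr0.
case: ifP => // /and4P[e t01 t01' /eqP Hp] [<-] /=.
have [->|ij] := eqVneq i j; last first.
  by rewrite mulr0 addr0.
rewrite Hp mulrCA -zweightE //; split; first exact: reach_move.
by rewrite distrC; apply: reach_move.
Qed.

Lemma exec_None (s : schedule R I) :
  foldl (fun st a => obind (fun st => step st a) st) None s = None.
Proof. by elim: s. Qed.

Lemma exec_cons a s (st st' : state R I) : exec (a :: s) st = Some st' ->
  exists2 st1, step st a = Some st1 & exec s st1 = Some st'.
Proof.
rewrite /exec /=; case E: (step st a) => [st1|]; last by rewrite exec_None.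
by exists st1.
Qed.

Lemma exec_split s1 s2 (st st' : state R I) : exec (s1 ++ s2) st = Some st' ->
  exists2 st1, exec s1 st = Some st1 & exec s2 st1 = Some st'.
Proof.
rewrite /exec foldl_cat; case: (foldl _ _ s1) => [st1|]; last by rewrite exec_None.
by exists st1.
Qed.

(** The second half reads the schedule backwards, which gives distances from home out of the return
    of the agent. *)
Lemma exec_reach q (s : schedule R I) st st' i x : exec s st = Some st' ->
  (reach q (pos st i) x -> reach q (pos st' i) (x + DR * travelled i s)) /\
  (reach q (pos st' i) x -> reach q (pos st i) (x + DR * travelled i s)).
Proof.
elim: s st x => [|a s IH] st x.
  by case=> <-; rewrite /travelled big_nil mulr0 addr0.
move=> /exec_cons[st1 E1 E2]; rewrite /travelled big_cons mulrDr -/(travelled i s).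
split=> h.
  by rewrite addrA; apply: (IH st1 _ E2).1; apply: (step_reach q i x E1).1.
by rewrite (addrC (DR * _)) addrA; apply: (step_reach q i _ E1).2; apply: (IH st1 _ E2).2.
Qed.

Definition near (z : loc R I) (x : V) (d : R) : Prop :=
  match z with
  | inl v => x = v /\ d = 0
  | inr (u, v, t) => (x = u /\ d = t * W u v) \/ (x = v /\ d = (1 - t) * W u v)
  end.

(* Either the two routes end on the same side of [z], or they pass the whole edge of [z]. *)
Lemma apex p q z x y : reach p z x -> reach q z y ->
  (exists v d a b, [/\ near z v d, within p v a, within q v b & a + b + 2 * d <= x + y]) \/
  (forall v d, near z v d -> exists a b, [/\ within p v a, within q v b & a + b <= x + y]).
Proof.
case: z => [v|[[u v] t]] /=.
  by move=> h1 h2; left; exists v, 0, x, y; split=> //; lra.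
move=> [e t01 h1] [_ _ h2]; have Euv := within_edge e; have Evu := within_sym Euv.
case: h1 h2 => h1 [] h2.
- left; exists u, (t * W u v), (x - t * W u v), (y - t * W u v).
  by split=> //; [left | lra].
- right=> v' d [[-> _]|[-> _]].
    by exists (x - t * W u v), (y - (1 - t) * W u v + W u v); split=> //;
       [exact: within_trans Evu | lra].
  by exists (x - t * W u v + W u v), (y - (1 - t) * W u v); split=> //;
     [exact: within_trans Euv | lra].
- right=> v' d [[-> _]|[-> _]].
    by exists (x - (1 - t) * W u v + W u v), (y - t * W u v); split=> //;
       [exact: within_trans Evu | lra].
  by exists (x - (1 - t) * W u v), (y - t * W u v + W u v); split=> //;
     [exact: within_trans Euv | lra].
- left; exists v, ((1 - t) * W u v), (x - (1 - t) * W u v), (y - (1 - t) * W u v).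
  by split=> //; [right | lra].
Qed.

Lemma near_within q z y x x' d d' : reach q z y -> near z x d -> near z x' d' ->
  within x x' (d + d').
Proof.
case: z => [v|[[u v] t]] /=.
  by move=> _ [-> ->] [-> ->]; apply: within0; rewrite addr0.
move=> [e t01 _]; have w0 := W_ge0 e; have Euv := within_edge e.
have h1 : 0 <= t * W u v by apply: mulr_ge0 => //; lra.
have h2 : 0 <= (1 - t) * W u v by apply: mulr_ge0 => //; lra.
case=> [[-> ->]|[-> ->]] [[-> ->]|[-> ->]]; try by apply: within0; lra.
  by apply: within_le Euv; lra.
by apply: within_le (within_sym Euv); lra.
Qed.

Lemma near_ex q z y : reach q z y -> exists x d, near z x d.
Proof.
case: z => [v|[[u v] t]] /=; first by exists v, 0.
by move=> _; exists u, (t * W u v); left.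
Qed.

(** Both tours through [z] are rerouted through vertices. If both make detours from endpoints at
    distances d and d', they save 2 d + 2 d', which pays twice for the way between these endpoints;
    a tour covering the whole edge of [z] adopts the vertex of the other tour instead. *)
Lemma meeting p q p' q' z x y x' y' : reach p z x -> reach q z y ->
  reach p' z x' -> reach q' z y' ->
  exists v v' a b a' b' d,
    [/\ within p v a /\ within q v b, within p' v' a' /\ within q' v' b',
        within v v' d, a + b <= x + y /\ a' + b' <= x' + y' &
        a + b + a' + b' + 2 * d <= x + y + x' + y'].
Proof.
move=> h1 h2 h1' h2'; have nn := near_within h1.
have self v d : near z v d -> 0 <= d.
  by move=> h; have /within_ge0 := nn _ _ _ _ h h; lra.
case: (apex h1 h2) => [[v [d [a [b [nv wp wq le]]]]]|H];
case: (apex h1' h2') => [[v' [d' [a' [b' [nv' wp' wq' le']]]]]|H'].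
- exists v, v', a, b, a', b', (d + d'); have := self _ _ nv; have := self _ _ nv'.
  by move=> ? ?; split=> //; [exact: nn nv nv' | lra | lra].
- have [a' [b' [wp' wq' le']]] := H' _ _ nv; have := self _ _ nv => d0.
  exists v, v, a, b, a', b', 0; split=> //; [exact: within0 | lra | lra].
- have [a [b [wp wq le]]] := H _ _ nv'; have := self _ _ nv' => d0.
  exists v', v', a, b, a', b', 0; split=> //; [exact: within0 | lra | lra].
- have [v [d nv]] := near_ex h1.
  have [a [b [wp wq le]]] := H _ _ nv; have [a' [b' [wp' wq' le']]] := H' _ _ nv.
  exists v, v, a, b, a', b', 0; split=> //; [exact: within0 | lra].
Qed.

End Reach.

Lemma cat_eq_cat T (s1 s2 t1 t2 : seq T) : s1 ++ s2 = t1 ++ t2 ->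
  (exists m, t1 = s1 ++ m /\ s2 = m ++ t2) \/ (exists m, s1 = t1 ++ m /\ t2 = m ++ s2).
Proof.
elim: s1 t1 => [|x s1 IH] [|y t1] /=.
- by move=> ->; left; exists [::].
- by move=> ->; left; exists (y :: t1).
- by move=> <-; right; exists (x :: s1).
- by case=> -> /IH[[m [-> ->]]|[m [-> ->]]]; [left | right]; exists m.
Qed.

(** * A feasible schedule passes the tests *)

Section Completeness.
Variables (R : realType) (I : instance).
Local Notation V := 'I_(nv I).
Local Notation agent := 'I_(na I).
Local Notation c := (mkctx (raw I)).
Local Notation D := (common_den (raw I)).
Local Notation at_ u := (inl u : loc R I).
Local Notation DR := (D%:~R : R).
Local Notation beta := (max_budget c).
Local Notation k := (na I).

Variables (sc : schedule R I) (stN : state R I).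
Hypotheses (scN : exec sc (init R I) = Some stN)
  (msgN : msg stN = inl (at_ (tgt I))) (posN : forall i, pos stN i = at_ (home i))
  (lenN : forall i, travelled i sc <= ratr (budget i)).

Definition visit (i : agent) (z : loc R I) : Prop :=
  exists s1 s2 st, [/\ sc = s1 ++ s2, exec s1 (init R I) = Some st & pos st i = z].

Lemma visit_home (i : agent) : visit i (at_ (home i)).
Proof. by exists [::], sc, (init R I). Qed.

(** The two visits cut the walk of the agent, which starts and ends at home, into three legs. If [z]
    comes first, the tour is read backwards. *)
Lemma visit_tour i q z : visit i (at_ q) -> visit i z -> exists x y w : R,
  [/\ within (home i) q w, reach q z y, reach (home i) z x &
      w + y + x <= (budget_of c i)%:~R].
Proof.
move=> [s1 [s2 [st1 [E1 X1 P1]]]] [t1 [t2 [st2 [E2 X2 P2]]]].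
have len s t u : sc = s ++ t ++ u ->
    DR * travelled i s + DR * travelled i t + DR * travelled i u <= (budget_of c i)%:~R.
  move=> E; rewrite budgetE -!mulrDr ler_pM2l ?D0 //; apply: le_trans (lenN i).
  by rewrite /travelled E !big_cat /= addrA.
have r0 (p : V) : reach p (at_ p) 0 by apply: within0.
have start s st : exec s (init R I) = Some st -> reach (home i) (pos st i) (DR * travelled i s).
  by move=> X; rewrite -[X in reach _ _ X]add0r; apply: (exec_reach _ _ _ X).1; apply: r0.
have stop s st : exec s st = Some stN -> reach (home i) (pos st i) (DR * travelled i s).
  move=> X; rewrite -[X in reach _ _ X]add0r; apply: (exec_reach _ _ _ X).2.
  by rewrite posN; apply: r0.
have [[m [Et Es]]|[m [Es Et]]] := cat_eq_cat (etrans (esym E1) E2).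
- move: X2; rewrite Et => /exec_split[st1']; rewrite X1 => -[<-] Xm.
  have [st2' X2' X3] : exists2 st, exec t1 (init R I) = Some st & exec t2 st = Some stN.
    by apply: exec_split; rewrite -E2.
  have Est2 : st2' = st2.
    move: X2'; rewrite Et => /exec_split[st1'']; rewrite X1 => -[<-].
    by rewrite Xm => -[].
  subst st2'.
  exists (DR * travelled i t2), (DR * travelled i m), (DR * travelled i s1); split.
  + by have := start _ _ X1; rewrite P1.
  + rewrite -P2 -[X in reach _ _ X]add0r; apply: (exec_reach _ _ _ Xm).1.
    by rewrite P1; apply: r0.
  + by rewrite -P2; apply: stop X3.
  + by apply: len; rewrite E2 Et catA.
- move: X1; rewrite Es => /exec_split[st2']; rewrite X2 => -[<-] Xm.
  have [st1' X1' X3] : exists2 st, exec s1 (init R I) = Some st & exec s2 st = Some stN.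
    by apply: exec_split; rewrite -E1.
  have Est1 : st1' = st1.
    move: X1'; rewrite Es => /exec_split[st2'']; rewrite X2 => -[<-].
    by rewrite Xm => -[].
  subst st1'.
  exists (DR * travelled i t1), (DR * travelled i m), (DR * travelled i s2); split.
  + by have := stop _ _ X3; rewrite P1.
  + rewrite -P2 -[X in reach _ _ X]add0r; apply: (exec_reach _ _ _ Xm).2.
    by rewrite P1; apply: r0.
  + by rewrite -P2; apply: start X2.
  + have := len t1 m s2; rewrite E1 Es -catA => /(_ erefl); lra.
Qed.

(** Both tours through the common point are rerouted by [meeting]; what the budgets then leave
    covers twice the way between the two vertices. *)
Lemma visit_meet i j q q' z : visit i (at_ q) -> visit i z -> visit j (at_ q') -> visit j z ->
  exists x y : V, [/\ tour c q i x <= budget_of c i, tour c q' j y <= budget_of c j &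
    dist c x y * 2 <= (budget_of c i - tour c q i x) + (budget_of c j - tour c q' j y)].
Proof.
move=> vq vz vq' vz'.
have [c3 [c2 [c1 [w1 r2 r3 le]]]] := visit_tour vq vz.
have [c3' [c2' [c1' [w1' r2' r3' le']]]] := visit_tour vq' vz'.
have [x [y [a [b [a' [b' [d [[wa wb] [wa' wb'] wd [h h'] hh]]]]]]]] := meeting r3 r2 r3' r2'.
have {}w1 := within_dist w1; have {}w1' := within_dist w1'.
have {}wa := within_dist wa; have {}wb := within_dist wb.
have {}wa' := within_dist wa'; have {}wb' := within_dist wb'.
have {}wd := within_dist wd.
exists x, y; rewrite /tour !homeE -!(ler_int R) !(intrD, intrB, intrM).
by split; lra.
Qed.

Lemma solo_complete i : visit i (at_ (src I)) -> visit i (at_ (tgt I)) -> solo_ok c i.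
Proof.
move=> csize vt; have [x [y [w [h1 h2 h3 le]]]] := visit_tour csize vt.
have := within_dist h1; have := within_dist h2; have := within_dist h3.
by rewrite /solo_ok /tour homeE -(ler_int R) !intrD; lra.
Qed.

(** A common point is asked for, not a common time, since a dropped message waits. Visits involve
    real positions, hence the classical truth value. *)
Definition meets : rel agent := fun i j => `[< exists z, visit i z /\ visit j z >].

(** The agent [a] is the first carrier. A pick-up at [z] extends the chain of meetings, because an
    agent already connected to [a] has visited [z] as well. *)
Lemma carrier s1 s2 st : sc = s1 ++ s2 -> exec s1 (init R I) = Some st ->
  msg st = inl (at_ (src I)) \/
  exists2 a, visit a (at_ (src I)) &
    match msg st with
    | inr i => connect meets a i
    | inl z => exists2 i, visit i z & connect meets a i
    end.
Proof.
elim/last_ind: s1 s2 st => [|s b IH] s2 st; first by move=> _ [<-]; left.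
rewrite cat_rcons => Es; rewrite -cats1 => /exec_split[st1 X1 /exec_cons[st' Xb [Est]]].
subst st'.
have vis i : visit i (pos st1 i) by exists s, (b :: s2), st1.
have {}IH := IH _ _ Es X1.
move: Xb; case: b {Es} => [j u v t t'|j|j] /=.
- by case: ifP => // _ [<-].
- case: eqP => // Em [<-] /=; right.
  case: IH => [E|[a va]]; last first.
    rewrite Em => -[i vi cai]; exists a => //.
    apply: connect_trans cai (connect1 _).
    by apply/asboolP; exists (pos st1 j).
  exists j; last exact: connect0.
  by have := vis j; move: Em; rewrite E => -[<-].
- case: eqP => // Em [<-] /=; right.
  case: IH => [|[a va]]; first by rewrite Em.
  by rewrite Em => caj; exists a => //; exists j.
Qed.

(** The base of an inner agent is its home and not the vertex [y] of the meeting: the round trip to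
    [y] inside the tour pays for extending the route from [y] to home. The bound on [r] keeps all
    distances in the range of genuine routes. *)
Lemma dist_mid_right (x y : V) (j : agent) (r : int) : tour c (home j) j y <= budget_of c j ->
  dist c x y * 2 <= r + (budget_of c j - tour c (home j) j y) -> r <= beta ->
  dist c x (home j) * 2 <= r + budget_of c j.
Proof.
rewrite /tour homeE => h1 h2 h3; have hb := budget_le j.
have := dist_ge0 (home j) (home j); have := dist_ge0 (home j) y; have := dist_ge0 x y => p1 p2 p3.
have hjy : dist c (home j) y <= beta by lia.
have hyj := dist_sym R hjy.
have := @dist_triangle R I x y (home j).
by move=> /(_ ltac:(lia) ltac:(lia)); lia.
Qed.

Lemma dist_mid_left (x y : V) (j : agent) (r : int) : tour c (home j) j x <= budget_of c j ->
  dist c x y * 2 <= (budget_of c j - tour c (home j) j x) + r -> r <= beta ->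
  dist c (home j) y * 2 <= budget_of c j + r.
Proof.
rewrite /tour homeE => h1 h2 h3; have hb := budget_le j.
have := dist_ge0 (home j) (home j); have := dist_ge0 (home j) x; have := dist_ge0 x y => p1 p2 p3.
have := @dist_triangle R I (home j) x y.
by move=> /(_ ltac:(lia) ltac:(lia)); lia.
Qed.

Lemma meets_mid (i j : agent) : meets i j ->
  dist c (home i) (home j) * 2 <= budget_of c i + budget_of c j.
Proof.
move=> /asboolP[z [vi vj]].
have [x [y [ti tj d]]] := visit_meet (visit_home i) vi (visit_home j) vj.
have ti0 : 0 <= tour c (home i) i x by apply: tour_ge0.
apply: (@dist_mid_left x (home j) i) => //; last exact: budget_le.
apply: (dist_mid_right tj); first by lia.
by have := budget_le i; lia.
Qed.

(** A path without repetition has fewer edges than there are agents, so the shortest one stays below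
    the bogus cost. *)
Lemma good_guessP (a b : agent) (x y : V) p : a != b -> path meets a p -> uniq (a :: p) ->
  last a p = b ->
  tour c (src I) a x <= budget_of c a -> tour c (tgt I) b y <= budget_of c b ->
  let g := (nat_of_ord a, (nat_of_ord x, (nat_of_ord b, nat_of_ord y))) in
  path (fun i j : agent => adjacent c g i j) a p -> good_guess c g.
Proof.
move=> ab pm U El ta tb g pa.
have nab : (nat_of_ord a == nat_of_ord b) = false by apply/negbTE.
rewrite /good_guess /= nab /= /residual /= eqxx eq_sym nab eqxx !subr_ge0 ta tb /=.
have Hr : forall i : agent, path (fun i j : agent => adjacent c g i j) i p ->
    is_route (agent_graph c g) i [seq (nat_of_ord j, 1) | j <- p].
  elim: p {pm U El pa} => //= j p IH i /andP[h1 h2]; rewrite IH // andbT.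
  rewrite nth_agent_graph ?nagentsE ?ltn_ord //; apply/mapP; exists (nat_of_ord j) => //.
  by rewrite mem_filter h1 mem_iota ltn_ord.
have {}Hr := Hr _ pa.
have El' : rlast a [seq (nat_of_ord j, 1) | j <- p] = b.
  by rewrite /rlast -map_comp -El; elim: p (a) {pm U El pa Hr} => //= j p IH i; apply: IH.
have [al bl] : (nat_of_ord a < size (agent_graph c g))%N /\
    (nat_of_ord b < size (agent_graph c g))%N.
  by rewrite size_agent_graph nagentsE !ltn_ord.
have k0 : 0 <= Posz (nagents c) by [].
have := sp_le (@wf_agent_graph c g) k0 al bl Hr El'.
rewrite -/(team_route c g) => le; apply: le_lt_trans le _.
rewrite (rcost_agents Hr) size_map nagentsE.
have := card_uniqP U => /= E; have := max_card (mem (a :: p)); rewrite E card_ord; lia.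
Qed.

(** The chain of meetings from a visitor of the source to a visitor of the target is made simple, so
    that its inner members differ from both ends and are based at home. If both ends coincide, a
    single agent suffices. *)
Lemma complete : (exists i : agent, solo_ok c i) \/
  exists (a b : agent) (x y : V),
    good_guess c (nat_of_ord a, (nat_of_ord x, (nat_of_ord b, nat_of_ord y))).
Proof.
have [Em|[a va]] := carrier (esym (cats0 sc)) scN.
  by move: Em; rewrite msgN => -[E]; have := src_neq_tgt I; rewrite E eqxx.
rewrite msgN => -[b vb /connectP[p0 pp0 Eb0]].
move: Eb0; case/shortenP: pp0 => p pp U _ Eb.
have [ab|ab] := eqVneq a b.
  by left; exists a; apply: solo_complete => //; rewrite ab.
right; case/lastP: p pp U Eb => [|p b']; first by move=> _ _ /= E; rewrite E eqxx in ab.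
rewrite last_rcons => pp U Eb; subst b'.
have nab : (nat_of_ord b == nat_of_ord a) = false by rewrite eq_sym; apply/negbTE.
case: p pp U => [|j p] pp U.
  (* Both end agents meet directly, and this one meeting determines both bases. *)
  have /= := pp; rewrite andbT => /asboolP[z [vaz vbz]].
  have [x [y [ta tb d]]] := visit_meet va vaz vb vbz.
  exists a, b, x, y; apply: (good_guessP ab pp U) => //=.
  by rewrite andbT /adjacent /base /residual /= !eqxx nab.
have := pp; rewrite rcons_cons /= rcons_path => /and3P[maj pjp mlb].
set l := last j p in mlb.
(* The base of [a] comes from its meeting with its successor [j], that of [b] from the meeting with
   its predecessor [l], which may be the same agent. *)
have /asboolP[z [vaz vjz]] := maj; have /asboolP[z' [vlz vbz]] := mlb.
have [x [x' [ta tj d1]]] := visit_meet va vaz (visit_home j) vjz.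
have [y' [y [tl tb d2]]] := visit_meet (visit_home l) vlz vb vbz.
exists a, b, x, y; apply: (good_guessP ab pp U) => //; first by rewrite last_rcons.
set g := (nat_of_ord a, _).
have mid : forall i, i \in j :: p -> base c g i = home i /\ residual c g i = budget_of c i.
  move=> i Hi; move: U; rewrite cons_uniq mem_rcons in_cons negb_or rcons_uniq.
  move=> /and3P[/andP[_ aj] bj _].
  have na : (nat_of_ord i == nat_of_ord a) = false.
    by apply/negbTE/eqP => /ord_inj E; rewrite E in Hi; rewrite Hi in aj.
  have nb : (nat_of_ord i == nat_of_ord b) = false.
    by apply/negbTE/eqP => /ord_inj E; rewrite E in Hi; rewrite Hi in bj.
  by rewrite /base /residual /g /= na nb homeE.
have [bj rj] := mid j (mem_head _ _).
have [bl rl] := mid l (mem_last _ _).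
have [ba ra] : base c g a = x /\ residual c g a = budget_of c a - tour c (src I) a x.
  by rewrite /base /residual /g /= eqxx.
have [bb rb] : base c g b = y /\ residual c g b = budget_of c b - tour c (tgt I) b y.
  by rewrite /base /residual /g /= nab eqxx.
rewrite rcons_cons /= rcons_path -/l; apply/and3P; split.
- rewrite /adjacent ba bj ra rj; apply: (dist_mid_right tj d1).
  by have := tour_ge0 (src I) x a; have := budget_le a; lia.
- have : {in j :: p &, forall i i', meets i i' -> adjacent c g i i'}.
    move=> i i' /mid[bi ri] /mid[bi' ri'] /meets_mid.
    by rewrite /adjacent bi ri bi' ri'.
  move=> sub; apply: (sub_in_path (P := mem (j :: p)) _ _ pjp); first exact: sub.
  exact/allP.
- rewrite /adjacent bl bb rl rb; apply: (dist_mid_left tl d2).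
  by have := tour_ge0 (tgt I) y b; have := budget_le b; lia.
Qed.

End Completeness.

Lemma foldl_last_option T (s : seq T) z :
  foldl (fun _ x => Some x) z s = if s is x :: s' then Some (last x s') else z.
Proof. by elim: s z => [|x s IH] z //=; rewrite IH; case: s {IH}. Qed.

Lemma last_map_mem (T : eqType) U (f : T -> U) s x :
  exists2 y, y \in x :: s & last (f x) (map f s) = f y.
Proof. by exists (last x s); [exact: mem_last | rewrite last_map]. Qed.

(** * Correctness of the answer *)

Section Solve.
Variables (R : realType) (I : instance).
Local Notation c := (mkctx (raw I)).
Local Notation D := (common_den (raw I)).
Local Notation k := (na I).

Lemma mem_guesses a x b y : ((a, (x, (b, y))) \in guesses c) =
  [&& (a < k)%N, (x < nv I)%N, (b < k)%N & (y < nv I)%N].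
Proof.
rewrite /guesses nagentsE size_graph.
apply/flattenP/and4P => [[_ /mapP[a' Ha ->] /flattenP[_ /mapP[x' Hx ->]]]|[Ha Hx Hb Hy]].
  move=> /flattenP[_ /mapP[b' Hb ->] /mapP[y' Hy [-> -> -> ->]]].
  by move: Ha Hx Hb Hy; rewrite !mem_iota.
exists (flatten [seq flatten [seq [seq (a, (x, (b, y))) | y <- iota 0 (nv I)]
    | b <- iota 0 k] | x <- iota 0 (nv I)]).
  by apply/mapP; exists a; rewrite ?mem_iota.
apply/flattenP; exists (flatten [seq [seq (a, (x, (b, y))) | y <- iota 0 (nv I)]
    | b <- iota 0 k]).
  by apply/mapP; exists x; rewrite ?mem_iota.
apply/flattenP; exists [seq (a, (x, (b, y))) | y <- iota 0 (nv I)].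
  by apply/mapP; exists b; rewrite ?mem_iota.
by apply/mapP; exists y; rewrite ?mem_iota.
Qed.

Lemma solve_Some w : solve (raw I) = Some w ->
  (exists2 j : 'I_k, solo_ok c j & w = solo c j) \/
  (exists2 g, (g \in guesses c) && good_guess c g & w = build c g).
Proof.
rewrite /solve foldl_cat !foldl_last_option.
case E: [seq g <- guesses c | good_guess c g] => [|g s] /=.
  case E1: [seq j <- iota 0 (nagents c) | solo_ok c j] => [|j s] //= [<-].
  have [i Hi ->] := last_map_mem (solo c) s j.
  rewrite -E1 mem_filter mem_iota nagentsE in Hi.
  by case/andP: Hi => Hi lt; left; exists (Ordinal lt).
move=> [<-]; have [g' Hg ->] := last_map_mem (build c) s g.
by rewrite -E mem_filter andbC in Hg; right; exists g'.
Qed.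

Lemma solve_None : solve (raw I) = None ->
  (forall j : 'I_k, ~~ solo_ok c j) /\ (forall g, g \in guesses c -> ~~ good_guess c g).
Proof.
rewrite /solve foldl_cat !foldl_last_option.
case E: [seq g <- guesses c | good_guess c g] => [|g s] //=.
case E1: [seq j <- iota 0 (nagents c) | solo_ok c j] => [|j s] //= _.
split=> [j|g Hg]; apply/negP => h.
  have : nat_of_ord j \in [seq j <- iota 0 (nagents c) | solo_ok c j].
    by rewrite mem_filter h mem_iota nagentsE ltn_ord.
  by rewrite E1.
by have : g \in [seq g <- guesses c | good_guess c g]; [rewrite mem_filter h | rewrite E].
Qed.

Definition ratio : rat := 1 + (k%:R - 2) / k%:R *
  \big[Num.max/0]_(p : 'I_k * 'I_k) (budget p.2 / budget p.1).

Hypothesis k2 : (2 <= k)%N.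

(** The excess is relative to the largest budget; the maximal ratio of two budgets turns it into a
    multiple of the own one. *)
Lemma ratio_budget (i j : 'I_k) :
  k%:R * budget i + (k%:R - 2) * budget j <= ratio * budget i * k%:R.
Proof.
have k2' : 2 <= k%:R :> rat by rewrite (ler_nat _ 2).
have i0 := budget_gt0 i.
have : budget j / budget i <= \big[Num.max/0]_(p : 'I_k * 'I_k) (budget p.2 / budget p.1).
  exact: (le_bigmax 0 (fun p : 'I_k * 'I_k => budget p.2 / budget p.1) (i, j)).
rewrite /ratio; move: (\big[_/_]_p _) => M.
rewrite ler_pdivrMr // => h.
have -> : (1 + (k%:R - 2) / k%:R * M) * budget i * k%:R =
    k%:R * budget i + (k%:R - 2) * (M * budget i) by field; lra.
by rewrite lerD2l ler_wpM2l //; lra.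
Qed.

Lemma scaled_budget (i : 'I_k) :
  (Posz k * budget_of c i + (Posz k - 2) * max_budget c)%:~R <=
    ratr (ratio * budget i) * (k%:Z * D)%:~R :> R.
Proof.
have [j Hj] : exists j : 'I_k, max_budget c <= budget_of c j.
  have [E|[j E]] := max_budgetP I; [exists i | by exists j; rewrite E].
  by rewrite E -(ler_int R) budgetE mulr_ge0 ?ler0z ?ler0q // ltW ?den_gt0 ?budget_gt0.
apply: (@le_trans _ _ (Posz k * budget_of c i + (Posz k - 2) * budget_of c j)%:~R).
  by rewrite ler_int lerD2l ler_wpM2l //; lia.
have := ratio_budget i j; rewrite -(ler_rat R).
rewrite -(ler_pM2l (D0 R I)).
rewrite !(intrD, intrB, intrM) !budgetE !rmorphD !rmorphM !rmorphB /= !ratr_nat.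
rewrite -!pmulrn; move: (ratr _) (ratr _) (ratr _) => x y z; lra.
Qed.

Lemma ratio_ge (i : 'I_k) : budget i <= ratio * budget i.
Proof.
have k0 : 0 < k%:R :> rat by rewrite ltr0n; lia.
rewrite -(ler_pM2r k0); apply: le_trans (ratio_budget i i).
have k2' : 2 <= k%:R :> rat by rewrite (ler_nat _ 2).
by rewrite mulrC lerDl mulr_ge0 ?subr_ge0 ?(ltW (budget_gt0 _)).
Qed.

Lemma solve_correct : @correct_answer R I ratio (enc (solve (raw I))).
Proof.
case E: (solve (raw I)) => [w|]; [right | left].
  have : exists s, dec_schedule R I (enc_seq w) = Some s /\
      feasible (fun i => ratr (ratio * budget i)) s.
    have [[j ok ->]|[[a [x [b y]]] /andP[+ ok] ->]] := solve_Some E.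
      by apply: solo_feasible => // i; rewrite ler_rat ratio_ge.
    rewrite mem_guesses => /and4P[al xl bl yl].
    by apply: build_feasible => // i; apply: scaled_budget.
  by case=> s [Ds Fs]; exists (enc_seq w), s; split=> //=; rewrite map_id.
split=> // s [st [X Em Ep El]].
have [no1 no2] := solve_None E.
have [[i ok]|[a [b [x [y ok]]]]] := complete X Em Ep El.
  by have := no1 i; rewrite ok.
by move: no2; move/(_ (nat_of_ord a, (nat_of_ord x, (nat_of_ord b, nat_of_ord y))));
   rewrite mem_guesses !ltn_ord ok => /(_ isT).
Qed.

End Solve.

Unset Implicit Arguments.

Theorem theorem3 (R : realType) :
  exists P : program,
    resource_augmented R (fun I => (2 <= na I)%N)
      (fun I => 1 + ((na I)%:R - 2) / (na I)%:R *
         \big[Num.max/0]_(p : 'I_(na I) * 'I_(na I))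
            (budget p.2 / budget p.1)) P.
Proof.
have [P [d HP]] := polyt_program polyt_solve.
exists P, 1%N, d => I k2; have [cost run le] := HP (raw I).
exists (enc (solve (raw I))), cost; rewrite enc_raw in run le.
by split; [exact: run | rewrite mul1n | exact: solve_correct].
Qed.
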